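(* Let $\lambda$ be a Perron number of degree $d\ge 3$ and spectral ratio $\rho$, and set $\mathbb{K}:=\mathbb{Q}(\lambda)$. Let $B(\mathbb{K},\rho)$ denote either $\big(\frac{8d}{1-\rho}\big)^{d^2}\tau_{\min}(\mathcal{O}_\mathbb{K})^{d/2}$ or $\big(\frac{8d}{1-\rho}\big)^{d^2}\sqrt{D_\mathbb{K}}$ (the statement holds for each choice). Let $M=1+\frac{4}{1-\rho}$ and \[\kappa(\mathbb{K},\rho):=\max\{d_{PF}(\alpha) : \alpha\in[1,M]\cap\mathbb{K}\text{ is a Perron number}\}.\] Then \[ d_{PF}(\lambda)\le \max\{2^{d^2}B(\mathbb{K},\rho),\ \kappa(\mathbb{K},\rho)\}. \]
   Context: A real algebraic integer $\lambda \geq 1$ is Perron if it is strictly larger in absolute value than all its other Galois conjugates; its spectral ratio is $\max_i|\lambda_i|/\lambda$ over Galois conjugates $\lambda_i\ne\lambda$. A non-negative real square matrix $A$ is primitive if $A^k$ has all entries positive for some natural $k$. The Perron--Frobenius degree $d_{PF}(\lambda)$ is the least dimension of a non-negative integral primitive matrix with spectral radius $\lambda$. $\mathcal{O}_\mathbb{K}$ is the ring of integers and $D_\mathbb{K}$ the discriminant of $\mathbb{K}$ (square of $\det(\sigma_i(\omega_j))$ for a $\mathbb{Z}$-basis $\omega_j$ of $\mathcal{O}_\mathbb{K}$ and all embeddings $\sigma_i$). Minimal Hermite-like thickness: let $\sigma_1,\dots,\sigma_r$ be the real embeddings and $\sigma_{r+1},\bar\sigma_{r+1},\dots,\sigma_{r+s},\bar\sigma_{r+s}$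 the complex ones ($r+2s=d$); identify $\mathbb{K}_\mathbb{R}=\mathbb{K}\otimes_\mathbb{Q}\mathbb{R}$ with $\mathbb{R}^r\times\mathbb{C}^s\cong\mathbb{R}^d$ via $x\mapsto(\sigma_1(x),\dots,\sigma_{r+s}(x))$. Let $\mathfrak{B}$ be the set of $\alpha\in\mathbb{R}^r\times\mathbb{C}^s$ with $\alpha=\bar\alpha$ and all components positive. For $\alpha\in\mathfrak B$ put $q_\alpha(x,x)=\sum_{i\le r}\alpha_i|\sigma_i(x)|^2+2\sum_{j>r}\alpha_j|\sigma_j(x)|^2$ (with associated bilinear form), $\max(\mathcal{O}_\mathbb{K},q_\alpha)=\inf\{u:\forall x\in\mathbb{K}_\mathbb{R}\,\exists y\in\mathcal{O}_\mathbb{K},\ q_\alpha(x-y,x-y)\le u\}$, $\det(\mathcal{O}_\mathbb{K},q_\alpha)$ the Gram determinant of $q_\alpha$ on a $\mathbb{Z}$-basis of $\mathcal{O}_\mathbb{K}$, $\tau(\mathcal{O}_\mathbb{K},q_\alpha)=\max(\mathcal{O}_\mathbb{K},q_\alpha)/\det(\mathcal{O}_\mathbb{K},q_\alpha)^{1/d}$, and $\tau_{\min}(\mathcal{O}_\mathbb{K})=\inf_{\alpha\in\mathfrak B}\tau(\mathcal{O}_\mathbb{K},q_\alpha)$.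
   Formalization: The square root of the discriminant D_K is read as the square root of its absolute value |D_K|, since D_K can be negative (for example −23 for the cubic field of the real root of X³−X−1). *)

(* Defs.v *)
(* MathComp + MathComp-Analysis (reals, sup/inf, powR)
   + real_closed's complex numbers R[i] over a realType R. *)
From HB Require Import structures.
From mathcomp Require Import all_boot all_order all_algebra.
From mathcomp Require Import boolp classical_sets reals exp.
From mathcomp Require Import complex.
Set Implicit Arguments.
Unset Strict Implicit.
Unset Printing Implicit Defensive.
Import Order.TTheory GRing.Theory Num.Theory.
Local Open Scope ring_scope.
Local Open Scope classical_set_scope.

Section Defs.
Variable R : realType.
Local Notation C := (R[i]).

(* modulus of a complex number, as a real *)
Definition absC (z : C) : R :=
  Num.sqrt (complex.Re z ^+ 2 + complex.Im z ^+ 2).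

(* evaluation of a rational polynomial at a complex number *)
Definition ev (q : {poly rat}) (z : C) : C := (map_poly ratr q).[z].

(* algebraic integer: root of a monic integer polynomial *)
Definition algint (z : C) : Prop :=
  exists p : {poly int}, p \is monic /\ root (map_poly intr p) z.

(* P is the minimal polynomial of a over Q *)
Definition minpolyQ (a : C) (P : {poly rat}) : Prop :=
  P \is monic /\ irreducible_poly P /\ root (map_poly ratr P) a.

(* degree of the minimal polynomial *)
Definition deg (P : {poly rat}) : nat := (size P).-1.

(* the (distinct) complex roots of P = the Galois conjugates;
   they index the complex embeddings of Q(a) = Q[X]/(P) *)
Definition conjs (P : {poly rat}) : seq C :=
  xget [::] (fun s : seq C =>
    uniq s /\ forall z, z \in s <-> root (map_poly ratr P) z).

(* Perron number *)
Definition perron (a : C) : Prop :=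
  a \is Num.real /\ 1 <= a /\ algint a /\
  exists P, minpolyQ a P /\
    forall z, root (map_poly ratr P) z -> z != a -> `|z| < a.

(* spectral ratio: max |a_i| / a over conjugates a_i <> a *)
Definition specratio (a : C) (P : {poly rat}) : R :=
  sup [set r | exists mu, root (map_poly ratr P) mu /\ mu != a /\
                          r = absC mu / complex.Re a].

(* the number field K = Q(a) *)
Definition inK (a b : C) : Prop := exists q : {poly rat}, b = ev q a.

(* the element q(a) of K lies in O_K (embeddings: q(a) |-> q(mu)) *)
Definition inOK (a : C) (q : {poly rat}) : Prop := algint (ev q a).

(* w is a Z-basis of O_K *)
Definition Zbasis (a : C) (P : {poly rat}) (w : 'I_(deg P) -> {poly rat}) : Prop :=
  (forall j, inOK a (w j)) /\
  (forall q, inOK a q -> exists c : 'I_(deg P) -> int,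
        ev q a = \sum_(j < deg P) (c j)%:~R * ev (w j) a) /\
  (forall c : 'I_(deg P) -> int,
        \sum_(j < deg P) (c j)%:~R * ev (w j) a = 0 -> forall j, c j = 0).

Arguments Zbasis a P w : clear implicits.

(* discriminant D_K = det(sigma_i(w_j))^2 (independent of the choices) *)
Definition discK (a : C) (P : {poly rat}) : C :=
  xget 0 (fun D : C => exists w, Zbasis a P w /\
    D = (\det (\matrix_(i < deg P, j < deg P) ev (w j) (nth 0 (conjs P) i))) ^+ 2).

(* alpha in the set frak B: positive, invariant under complex conjugation of
   the embedding (i.e. an element of (R_{>0})^r x (R_{>0})^s) *)
Definition admissible (P : {poly rat}) (alpha : C -> R) : Prop :=
  forall mu, mu \in conjs P -> 0 < alpha mu /\ alpha (mu^*) = alpha mu.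

(* x in K_R = {(x_sigma) : x_{bar sigma} = bar (x_sigma)} ~ R^r x C^s *)
Definition xsym (P : {poly rat}) (x : C -> C) : Prop :=
  forall mu, mu \in conjs P -> x (mu^*) = (x mu)^*.

(* q_alpha(x,x) : complex pairs are counted twice, i.e. 2 alpha_j |x_j|^2 *)
Definition qform (P : {poly rat}) (alpha : C -> R) (x : C -> C) : R :=
  \sum_(mu <- conjs P) alpha mu * absC (x mu) ^+ 2.

(* associated symmetric bilinear form *)
Definition bform (P : {poly rat}) (alpha : C -> R) (x y : C -> C) : R :=
  \sum_(mu <- conjs P) alpha mu * complex.Re (x mu * (y mu)^*).

(* max(O_K, q_alpha) *)
Definition covrad (a : C) (P : {poly rat}) (alpha : C -> R) : R :=
  inf [set u | forall x, xsym P x ->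
         exists q, inOK a q /\ qform P alpha (fun mu => x mu - ev q mu) <= u].

(* det(O_K, q_alpha): Gram determinant on a Z-basis *)
Definition gramdet (a : C) (P : {poly rat}) (alpha : C -> R) : R :=
  xget 0 (fun g : R => exists w, Zbasis a P w /\
    g = \det (\matrix_(j < deg P, k < deg P)
                 bform P alpha (ev (w j)) (ev (w k)))).

Definition tau (a : C) (P : {poly rat}) (alpha : C -> R) : R :=
  covrad a P alpha / powR (gramdet a P alpha) (1 / (deg P)%:R).

Definition taumin (a : C) (P : {poly rat}) : R :=
  inf [set t | exists alpha, admissible P alpha /\ t = tau a P alpha].

(* r is the spectral radius of B *)
Definition is_specrad (n : nat) (B : 'M[C]_n) (r : C) : Prop :=
  (exists z, eigenvalue B z /\ `|z| = r) /\
  (forall z, eigenvalue B z -> `|z| <= r).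

(* there is an n x n non-negative integral primitive matrix with spectral radius a *)
Definition pf_realizable (a : C) (n : nat) : Prop :=
  exists A : 'M[int]_n,
    (forall i j, 0 <= A i j) /\
    (exists k, forall i j, 0 < (A ^+ k.+1) i j) /\
    is_specrad (map_mx intr A) a.

(* Perron--Frobenius degree: least such n *)
Definition dPF (a : C) : nat :=
  xget 0%N (fun n => pf_realizable a n /\
                     forall m, pf_realizable a m -> (n <= m)%N).

(* kappa(K, rho) = max{ d_PF(b) : b in [1, M] cap K Perron }, M = 1 + 4/(1-rho) *)
Definition kappa (a : C) (rho : R) : R :=
  sup [set x | exists b, perron b /\ inK a b /\
                 1 <= b <= ((1 + 4 / (1 - rho))%:C)%C /\ x = (dPF b)%:R].

End Defs.

(* Main.v *)
Require Import Defs.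
From mathcomp Require Import all_boot all_order all_algebra all_fingroup.
From mathcomp Require Import separable algC algnum.
From mathcomp Require Import boolp classical_sets reals exp.
From mathcomp Require Import complex ring lra zify.
Import Order.TTheory GRing.Theory Num.Theory.
Local Open Scope ring_scope.
Set Implicit Arguments.
Unset Strict Implicit.
Unset Printing Implicit Defensive.

(* Write l for lam and e = 1 - rho.  If l <= 1 + 4 / e then lam itself occurs in
   the definition of kappa, and only finitely many Perron numbers do.

   Otherwise let r bound, in the embeddings scaled by weights a, the distance of
   every point of K_R to O_K.  Let S be the set of lattice points y in the cone
   |a_mu y_mu| <= a_lam y_lam around the dominant axis whose height a_lam y_lam is
   of order r / e.  Multiplication by lam contracts the cone by rho, so lam y lies
   deep inside it, even after subtracting a fixed b in S near the axis.  Cutting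
   z = lam y - b into k equal pieces and rounding the partial sums j z / k to
   lattice points writes lam y as b plus a sum of k elements of S.  The resulting
   non-negative integer matrix has the heights as a positive eigenvector, and b
   makes its part reachable from b primitive.  The size of S is at most a constant
   times r^d / (prod a * sqrt |D|).

   Taking a = sqrt alpha and r^2 close to the covering constant of q_alpha gives the
   bound by tau_min.  For the discriminant take a = 1: by Hermite reduction O_K has
   a basis f with prod |f_j|^2 <= C |D|.  With T^d = C |D|, the products f_j f_k
   such that |f_j| |f_k| <= T span K, hence r = d T is admissible. *)

(** * Modulus of complex numbers *)

Section Modulus.
Variable R : realType.
Implicit Types (x y : R[i]).

Lemma normC_absC x : `|x| = ((absC x)%:C)%C.
Proof. by rewrite normc_def. Qed.

Lemma absC_ge0 x : 0 <= absC x. Proof. exact: sqrtr_ge0. Qed.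

Lemma absCM x y : absC (x * y) = absC x * absC y.
Proof. by apply: complexI; rewrite rmorphM /= -!normC_absC normrM. Qed.

Lemma absCD x y : absC (x + y) <= absC x + absC y.
Proof. by rewrite -lecR rmorphD /= -!normC_absC ler_normD. Qed.

Lemma absCN x : absC (- x) = absC x.
Proof. by apply: complexI; rewrite -!normC_absC normrN. Qed.

Lemma absC_real (t : R) : absC (t%:C)%C = `|t|.
Proof. by rewrite /absC /= expr0n /= addr0 sqrtr_sqr. Qed.

Lemma absC_nat n : absC (n%:R : R[i]) = n%:R.
Proof. by rewrite -(rmorph_nat (real_complex R)) absC_real normr_nat. Qed.

Lemma absC_int (m : int) : absC (m%:~R : R[i]) = `|m|%:~R.
Proof. by rewrite -(rmorph_int (real_complex R)) absC_real intr_norm. Qed.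

Lemma absC_eq0 x : (absC x == 0) = (x == 0).
Proof. by rewrite -[RHS]normr_eq0 normC_absC fmorph_eq0. Qed.

Lemma absC0 : absC (0 : R[i]) = 0. Proof. by apply/eqP; rewrite absC_eq0. Qed.

Lemma absC1 : absC (1 : R[i]) = 1. Proof. exact: absC_nat 1. Qed.

Lemma absCX x n : absC (x ^+ n) = absC x ^+ n.
Proof. by elim: n => [|n IH]; rewrite ?expr0 ?absC1 // !exprS absCM IH. Qed.

Lemma absC_sum (I : Type) (r : seq I) (P : pred I) (F : I -> R[i]) :
  absC (\sum_(i <- r | P i) F i) <= \sum_(i <- r | P i) absC (F i).
Proof.
elim/big_rec2: _ => [|i y1 y2 _ h]; first by rewrite absC0.
by rewrite (le_trans (absCD _ _)) // lerD2l.
Qed.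

Lemma absC_prod (I : Type) (r : seq I) (P : pred I) (F : I -> R[i]) :
  absC (\prod_(i <- r | P i) F i) = \prod_(i <- r | P i) absC (F i).
Proof. by elim/big_rec2: _ => [|i y1 y2 _ <-]; rewrite ?absC1 ?absCM. Qed.

Lemma sqr_absC x : ((absC x ^+ 2)%:C)%C = x * x^*.
Proof. by rewrite rmorphXn /= -normC_absC normCK. Qed.

Lemma ReB x y : complex.Re (x - y) = complex.Re x - complex.Re y.
Proof. by case: x y => [? ?] []. Qed.

Lemma Re_sum (I : Type) (r : seq I) (P : pred I) (F : I -> R[i]) :
  complex.Re (\sum_(i <- r | P i) F i) = \sum_(i <- r | P i) complex.Re (F i).
Proof.
elim/big_rec2: _ => [//|i y1 y2 _ <-]; by case: (F i) y2 => [? ?] [].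
Qed.

Lemma Re_realM (t : R) x : complex.Re ((t%:C)%C * x) = t * complex.Re x.
Proof. by case: x => [u v] /=; rewrite mul0r subr0. Qed.

Lemma Re_conjE x : complex.Re (x^*) = complex.Re x.
Proof. by case: x. Qed.

(** Each of the [d!] terms of the Leibniz expansion takes one entry from every column. This crude
    Hadamard bound is precise enough for all later counting. *)
Lemma det_absC_le d (M : 'M[R[i]]_d) (c : 'I_d -> R) :
  (forall i j, absC (M i j) <= c j) -> absC (\det M) <= d`!%:R * \prod_j c j.
Proof.
move=> Mc; rewrite /determinant; apply: le_trans (absC_sum _ _ _) _.
rewrite -card_Sn -sum1_card natr_sum mulr_suml; apply: ler_sum => s _.
rewrite mul1r absCM absC_prod absCX absCN absC1 expr1n mul1r.
rewrite [leRHS](reindex_inj (@perm_inj _ s)) /=.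
by apply: ler_prod => i _; rewrite absC_ge0 Mc.
Qed.
End Modulus.

(** * Primitive matrices from a positive eigenvector *)

Section Realize.
Variables (R : realType) (T : finType) (A : T -> T -> nat) (b : T).
Hypothesis Ab : forall s, (0 < A s b)%N.

Let e : rel T := fun s t => (0 < A s t)%N.
(** Every state has an edge back to [b], so the states reachable from [b] form one strongly
    connected class, and the loop at [b] makes it aperiodic. *)
Let U : pred T := connect e b.
Let B : 'M[int]_#|U| := \matrix_(i, j) (A (enum_val i) (enum_val j))%:Z.

Lemma expmx_ge0 n (M : 'M[int]_n) k i j :
  (forall i j, 0 <= M i j) -> 0 <= (M ^+ k) i j.
Proof.
move=> M0; elim: k i j => [|k IH] i j; first by rewrite expr0 mxE ler0n.
by rewrite exprS mxE sumr_ge0 // => l _; rewrite mulr_ge0.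
Qed.

Lemma mulmx_gt0_entry m n p (M : 'M[int]_(m, n)) (N : 'M[int]_(n, p)) i j l :
  (forall i j, 0 <= M i j) -> (forall i j, 0 <= N i j) ->
  0 < M i l -> 0 < N l j -> 0 < (M *m N) i j.
Proof.
move=> M0 N0 Mp Np; rewrite mxE (bigD1 l) //= ltr_wpDr ?mulr_gt0 //.
by rewrite sumr_ge0 // => k _; rewrite mulr_ge0.
Qed.

Let B0 i j : 0 <= B i j. Proof. by rewrite mxE. Qed.

Let Ub : b \in U. Proof. exact: connect0. Qed.
Let rk := enum_rank_in Ub.

Let Bib i : 0 < B i (rk b).
Proof. by rewrite mxE /rk enum_rankK_in // ltz_nat; exact: Ab. Qed.

(** Spare steps are spent on the loop at [b]. *)
Let Bloop k j : 0 < (B ^+ k) (rk b) j ->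
  forall k', (k <= k')%N -> 0 < (B ^+ k') (rk b) j.
Proof.
move=> Bk k' /subnK <-; elim: (k' - k)%N => // l IH.
rewrite addSn exprS; apply: (mulmx_gt0_entry (l := rk b)) => // i j'.
exact: expmx_ge0.
Qed.

Let Breach j : exists k, 0 < (B ^+ k) (rk b) j.
Proof.
suff H p : path e b p -> exists k, 0 < (B ^+ k) (rk b) (rk (last b p)).
  have /connectP [p pp Dt] := enum_valP j.
  by have [k] := H p pp; rewrite -Dt /rk enum_valK_in; exists k.
elim/last_ind: p => [|p t IH]; first by exists 0%N; rewrite expr0 mxE eqxx.
rewrite rcons_path last_rcons => /andP[pp ep].
have Ul : last b p \in U by apply/connectP; exists p.
have Ut : t \in U by apply: (connect_trans Ul); exact: connect1.
have [k Hk] := IH pp; exists k.+1; rewrite exprSr.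
apply: (mulmx_gt0_entry (l := rk (last b p))) => //.
  by move=> i j'; exact: expmx_ge0.
by rewrite mxE /rk !enum_rankK_in.
Qed.

(** Walk from [i] to [b] in one step, wait there, then go on to [j]; the sum of all walk lengths
    [f j] is an exponent common to all targets. *)
Let Bprim : exists k, forall i j, 0 < (B ^+ k.+1) i j.
Proof.
have [f Hf] := choice Breach.
exists (\sum_j f j)%N => i j; rewrite exprS.
apply: (mulmx_gt0_entry (l := rk b)) => //.
  by move=> *; exact: expmx_ge0.
by apply: (Bloop (Hf j)) => //; rewrite (bigD1 j) //= leq_addr.
Qed.

(* A positive right eigenvector pins down the spectral radius; restricting to
   the states reachable from [b] makes the matrix primitive. *)
Lemma realizable_of_eigenvector (v : T -> R) (l : R) :
  (forall s, 0 < v s) ->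
  (forall s, l * v s = \sum_t (A s t)%:R * v t) ->
  exists2 n, (n <= #|T|)%N & pf_realizable (l%:C)%C n.
Proof.
move=> v0 Av; exists #|U|; first by rewrite max_card.
exists B; split=> //; split=> //.
pose w (i : 'I_#|U|) : R[i] := ((v (enum_val i))%:C)%C.
have w0 i : 0 < w i by rewrite ltcR.
have l0 : 0 <= (l%:C)%C.
  rewrite lecR -(pmulr_lge0 _ (v0 b)) Av sumr_ge0 // => t _.
  by rewrite mulr_ge0 ?ler0n // ltW.
(* Restriction keeps the eigenvector equation: edges from reachable states lead only to reachable
   states. *)
have Bw i : \sum_j (B i j)%:~R * w j = (l%:C)%C * w i.
  rewrite /w -rmorphM /= Av rmorph_sum /=.
  rewrite [RHS](bigID U) /= [X in _ + X]big1 ?addr0; last first.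
    move=> t nct; suff /eqP -> : A (enum_val i) t == 0%N by rewrite mul0r.
    rewrite -leqn0 leqNgt; apply: contra nct => Ait.
    exact: connect_trans (enum_valP i) (connect1 _).
  rewrite [RHS](big_enum_val (A := U)) /=.
  by apply: eq_bigr => j _; rewrite mxE rmorphM /= rmorph_nat.
split.
  exists (l%:C)%C; split; last by rewrite ger0_norm.
  (* [eigenvalue] speaks of row vectors, whereas [w] is a column eigenvector; singularity of [l - B]
     passes from one side to the other. *)
  have: ~~ row_free ((l%:C)%C%:M - map_mx intr B).
    rewrite row_free_unit -unitmx_tr -row_free_unit -kermx_eq0.
    apply/rowV0Pn; exists (\row_i w i).
      apply/sub_kermxP/rowP => i; rewrite linearB /= tr_scalar_mx mulmxBr.
      rewrite mul_mx_scalar !mxE -(Bw i); apply/eqP; rewrite subr_eq0.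
      by apply/eqP/eq_bigr => j _; rewrite !mxE mulrC.
    apply/negP => /eqP/rowP/(_ (rk b)); rewrite !mxE => w00.
    by have := w0 (rk b); rewrite w00 ltxx.
  rewrite -kermx_eq0 => /rowV0Pn [y /sub_kermxP]; rewrite mulmxBr => /eqP.
  rewrite subr_eq0 mul_mx_scalar => /eqP yB y0.
  by apply/eigenvalueP; exists y.
move=> z /eigenvalueP [y yB y0].
(* Pairing the moduli of a left eigenvector with the positive [w] compares [|z|] with [l]. *)
have S0 : 0 < \sum_j `|y 0 j| * w j.
  have [j yj] : exists j, y 0 j != 0.
    apply/existsP; apply: contraNT y0; rewrite negb_exists => /forallP H.
    by apply/eqP/rowP => j; rewrite mxE; apply/eqP; have := H j; rewrite negbK.
  rewrite (bigD1 j) //= ltr_pwDl ?mulr_gt0 ?normr_gt0 //.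
  by rewrite sumr_ge0 // => k _; rewrite mulr_ge0 // ltW.
rewrite -(ler_pM2r S0) !mulr_sumr.
apply: (@le_trans _ _ (\sum_j \sum_i `|y 0 i| * (B i j)%:~R * w j)).
  apply: ler_sum => j _; rewrite mulrA -normrM -mulr_suml.
  apply: ler_wpM2r; first exact: ltW.
  have <- : (y *m map_mx intr B) 0 j = z * y 0 j by rewrite yB mxE.
  rewrite mxE; apply: le_trans (ler_norm_sum _ _ _) _.
  apply: ler_sum => i _; rewrite mxE normrM.
  by rewrite [X in _ * X]ger0_norm // ler0z.
rewrite exchange_big /=; apply: ler_sum => i _.
under eq_bigr do rewrite -mulrA.
by rewrite -mulr_sumr Bw mulrCA.
Qed.
End Realize.

(** * Classes modulo an integer matrix *)

Lemma absz_det_unit d (U : 'M[int]_d) : U \in unitmx -> `|\det U|%N = 1%N.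
Proof. by rewrite unitmxE => /orP[] /eqP ->. Qed.

(** With the Smith form [M = L D S], multiplication by the inverse of [S] carries the row lattice of
    [M] to that of the diagonal [D], so a class is a tuple of residues modulo the diagonal
    entries. *)
Lemma det_int_classes d (M : 'M[int]_d) : \det M != 0 ->
  exists (Q : finType) (cl : 'rV[int]_d -> Q), #|Q| = `|\det M|%N /\
    forall x y, cl x = cl y -> exists u, x - y = u *m M.
Proof.
move=> dM; have [L uL [S uS [s _ DM]]] := int_Smith_normal_form M.
have dL := absz_det_unit uL.
have dS := absz_det_unit uS.
set D := \matrix_(i, j) _ in DM.
have D_diag : D = diag_mx (\row_i s`_i).
  by apply/matrixP => i j; rewrite !mxE.
have dD : `|\det M|%N = (\prod_(i < d) `|(s`_i)%R|)%N.
  rewrite DM !det_mulmx !abszM dL dS mul1n muln1 D_diag det_diag.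
  rewrite (big_morph absz abszM (erefl _ : `|1%:Z|%N = 1%N)).
  by apply: eq_bigr => i _; rewrite mxE.
have s0 i : (i < d)%N -> (0 < `|(s`_i)%R|)%N.
  move=> id; rewrite absz_gt0; apply: contraNneq dM => si0.
  rewrite -absz_eq0 dD (bigD1 (Ordinal id)) //= si0.
  by rewrite absz0 mul0n.
(* The predecessor gives the residue type the successor shape that [inord] requires. *)
pose n (i : 'I_d) := (`|(s`_i)%R|).-1.
have nE i : (n i).+1 = `|(s`_i)%R|%N by rewrite /n prednK // s0.
exists {dffun forall i : 'I_d, 'I_(n i).+1}.
pose r (x : 'rV[int]_d) i := modz ((x *m invmx S) 0 i) s`_i.
exists (fun x => [ffun i => inord `|r x i|%N]).
split.
  rewrite card_dep_ffun dD foldrE big_map big_enum.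
  by apply: eq_bigr => i _; rewrite card_ord nE.
move=> x y /ffunP xy.
have H i : exists k, ((x - y) *m invmx S) 0 i = k * s`_i.
  have := congr1 val (xy i); rewrite !ffunE /=.
  have s0i : s`_i != 0 by rewrite -absz_gt0 s0.
  have bnd z : (`|(z %% s`_i)%Z| < (n i).+1)%N.
    by rewrite nE -ltz_nat gez0_abs ?modz_ge0 // abszE ltz_mod.
  rewrite !inordK ?bnd // => E.
  have {}E : r x i = r y i.
    by rewrite -[LHS]gez0_abs ?modz_ge0 // E gez0_abs ?modz_ge0.
  exists (divz ((x *m invmx S) 0 i - (y *m invmx S) 0 i) s`_i).
  rewrite divzK; last by rewrite -eqz_mod_dvd; apply/eqP.
  by rewrite mulmxBl !mxE.
have [k Hk] := choice H.
exists (\row_i k i *m invmx L).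
rewrite DM !mulmxA mulmxKV // -[LHS](mulmxKV uS); congr (_ *m S).
by apply/rowP => i; rewrite D_diag mul_mx_diag [RHS]mxE Hk !mxE.
Qed.

(** * Reduction of positive definite forms *)

Section QuadraticForms.
Variable R : realType.

Definition quad d (G : 'M[R]_d) (x : 'rV[R]_d) : R := (x *m G *m x^T) 0 0.

Definition posdef d (G : 'M[R]_d) : Prop :=
  G^T = G /\ forall x : 'rV[R]_d, x != 0 -> 0 < quad G x.

Lemma quad_row m d (G : 'M[R]_d) (U : 'M[R]_(m, d)) i :
  (U *m G *m U^T) i i = quad G (row i U).
Proof.
rewrite /quad -row_mul [LHS]mxE [RHS]mxE; apply: eq_bigr => j _.
by congr (_ * _); rewrite ?[in RHS]mxE // !mxE.
Qed.

Lemma quad_ge0 d (G : 'M[R]_d) x : posdef G -> 0 <= quad G x.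
Proof.
move=> [_ G0]; have [->|/G0/ltW //] := eqVneq x 0.
by rewrite /quad !mul0mx mxE.
Qed.

Lemma quad_cong d (G S : 'M[R]_d) x : quad (S *m G *m S^T) x = quad G (x *m S).
Proof. by rewrite /quad trmx_mul !mulmxA. Qed.

Lemma posdef_cong d (G S : 'M[R]_d) :
  S \in unitmx -> posdef G -> posdef (S *m G *m S^T).
Proof.
move=> uS [Gs G0]; split; first by rewrite !trmx_mul trmxK Gs mulmxA.
move=> x x0; rewrite quad_cong G0 //; apply: contraNneq x0 => xS.
by rewrite -(mulmxK uS x) xS mul0mx.
Qed.

Lemma posdef_unit d (G : 'M[R]_d) : posdef G -> G \in unitmx.
Proof.
move=> [_ G0]; rewrite -row_free_unit -kermx_eq0; apply/negPn/negP.
move=> /rowV0Pn [y /sub_kermxP yG y0].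
by have := G0 _ y0; rewrite /quad yG mul0mx mxE ltxx.
Qed.

Lemma bilin_sym d (G : 'M[R]_d) (x y : 'rV_d) :
  G^T = G -> (x *m G *m y^T) 0 0 = (y *m G *m x^T) 0 0.
Proof.
move=> Gs; transitivity ((x *m G *m y^T)^T 0 0); first by rewrite [RHS]mxE.
by rewrite !trmx_mul trmxK Gs mulmxA.
Qed.

Lemma quadB d (G : 'M[R]_d) (x y : 'rV_d) : G^T = G ->
  quad G (x - y) = quad G x - 2 * (y *m G *m x^T) 0 0 + quad G y.
Proof.
have eB (A B : 'M[R]_1) : (A - B) 0 0 = A 0 0 - B 0 0 by rewrite !mxE.
move=> Gs; rewrite /quad linearB /= mulmxBr !mulmxBl !eB.
by rewrite (bilin_sym x y Gs); ring.
Qed.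

(* Cauchy-Schwarz against the dual basis vector [delta_i G^-1]. *)
Lemma posdef_coord_le d (G : 'M[R]_d) i : posdef G ->
  exists2 c, 0 < c & forall x : 'rV_d, x 0 i ^+ 2 <= c * quad G x.
Proof.
move=> pG; have [Gs G0] := pG; have uG := posdef_unit pG.
pose y : 'rV_d := delta_mx 0 i *m invmx G.
have yG : y *m G = delta_mx 0 i by rewrite mulmxKV.
have c0 : 0 < quad G y.
  apply: G0; apply/eqP => y0; move: yG; rewrite y0 mul0mx => /matrixP/(_ 0 i).
  by rewrite !mxE !eqxx => /eqP; rewrite eq_sym oner_eq0.
exists (quad G y) => // x.
have eZ c (A : 'M[R]_1) : (c *: A) 0 0 = c * A 0 0 by rewrite mxE.
have H t : quad G (x - t *: y) = quad G x - 2 * t * x 0 i + t ^+ 2 * quad G y.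
  have E : (y *m G *m x^T) 0 0 = x 0 i by rewrite yG -rowE !mxE.
  rewrite quadB // -E /quad linearZ /= -!(scalemxAl, scalemxAr) scalerA.
  by rewrite !eZ; ring.
(* This multiple of [y] minimises the quadratic polynomial [H] in [t]. *)
have := quad_ge0 (x - (x 0 i / quad G y) *: y) pG; rewrite H.
move: (quad G y) c0 (quad G x) (x 0 i) => c c0 q z.
have -> : q - 2 * (z / c) * z + (z / c) ^+ 2 * c = (c * q - z ^+ 2) / c.
  by field; rewrite gt_eqF.
by rewrite pmulr_lge0 ?invr_gt0 // subr_ge0.
Qed.

Lemma seq_argmin (T : eqType) (f : T -> R) (s : seq T) x0 : x0 \in s ->
  exists2 x, x \in s & forall y, y \in s -> f x <= f y.
Proof.
elim: s x0 => // z s IH x0 _.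
case: s IH => [|z' s] IH.
  by exists z; rewrite ?mem_head // => y; rewrite inE => /eqP ->.
have [x xs xm] := IH z' (mem_head _ _).
have [zx|xz] := leP (f z) (f x).
  exists z; rewrite ?mem_head // => y; rewrite inE => /orP[/eqP -> //|/xm].
  exact: le_trans.
exists x; first by rewrite inE xs orbT.
by move=> y; rewrite inE => /orP[/eqP ->|/xm //]; apply: ltW.
Qed.

Lemma int_box_finite d (N : nat) :
  exists s : seq 'rV[int]_d, forall x : 'rV[int]_d, (forall i, `|x 0 i| <= N%:Z) -> x \in s.
Proof.
pose g (f : {ffun 'I_d -> 'I_(N + N).+1}) : 'rV[int]_d := \row_i ((f i)%:Z - N%:Z).
exists (codom g) => x xN; apply/codomP.
pose y i := x 0 i + N%:Z.
exists [ffun i => inord (absz (y i))].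
apply/rowP => i; rewrite mxE ffunE; have h := xN i; rewrite -[LHS]/(x 0 i) inordK; rewrite /y; lia.
Qed.

(** The form bounds every coordinate, so the integer vectors with value at most that of a basis
    vector [e] lie in a finite box. *)
Lemma posdef_int_min d (G : 'M[R]_d.+1) : posdef G ->
  exists2 b : 'rV[int]_d.+1, b != 0 &
    forall z : 'rV[int]_d.+1, z != 0 ->
      quad G (map_mx intr b) <= quad G (map_mx intr z).
Proof.
move=> pG; pose Q (z : 'rV[int]_d.+1) := quad G (map_mx intr z).
have [c Hc] := choice (fun i => let: ex_intro2 c c0 h := posdef_coord_le i pG in
  ex_intro (fun c => 0 < c /\ forall x : 'rV[R]_d.+1, x 0 i ^+ 2 <= c * quad G x) c (conj c0 h)).
pose e : 'rV[int]_d.+1 := delta_mx 0 0.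
have e0 : e != 0 by apply/eqP => /matrixP/(_ 0 0)/eqP; rewrite !mxE.
(* The summand 1 yields [t <= N] from [t ^+ 2 <= S] without a square root. *)
pose N := (Num.bound (1 + \sum_i c i * Q e)).
have [s sP] := int_box_finite d.+1 N.
have Qs z : Q z <= Q e -> z \in s.
  move=> ze; apply: sP => i; rewrite -(ler_int R) intr_norm.
  have S0 : 0 <= \sum_i c i * Q e.
    by apply: sumr_ge0 => j _; rewrite mulr_ge0 ?quad_ge0 // ltW; case: (Hc j).
  have zi : (z 0 i)%:~R ^+ 2 <= \sum_i c i * Q e.
    have [ci0 Hi] := Hc i; have := Hi (map_mx intr z); rewrite mxE => /le_trans; apply.
    rewrite (bigD1 i) //= ler_wpDr //.
      by apply: sumr_ge0 => j _; rewrite mulr_ge0 ?quad_ge0 // ltW; case: (Hc j).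
    by rewrite ler_wpM2l // ltW.
  have : 1 + \sum_i c i * Q e < N%:R.
    by apply: le_lt_trans (archi_boundP _); rewrite ?addr_ge0.
  move: (\sum_i _) S0 zi => S S0 zi SN; rewrite -pmulrn.
  have : `|(z 0 i)%:~R : R| ^+ 2 <= S by rewrite real_normK ?num_real.
  by move: `|_| (normr_ge0 ((z 0 i)%:~R : R)) => t t0; nra.
have [b bs bm] := @seq_argmin _ Q [seq z <- s | z != 0] e
  ltac:(by rewrite mem_filter e0 Qs).
move: bs; rewrite mem_filter => /andP[b0 _]; exists b => // z z0.
have [ze|/ltW ez] := leP (Q z) (Q e).
  by apply: bm; rewrite mem_filter z0 Qs.
by apply: le_trans ez; apply: bm; rewrite mem_filter e0 Qs.
Qed.

End QuadraticForms.

(** * Hermite reduction of Gram matrices *)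

Section Hermite.
Variable R : realType.

Lemma map_mx_intr_unit d (U : 'M[int]_d) :
  U \in unitmx -> map_mx (intr : int -> R) U \in unitmx.
Proof. by rewrite !unitmxE det_map_mx; apply: rmorph_unit. Qed.

Lemma det_intr_cong d (U : 'M[int]_d) (G : 'M[R]_d) : U \in unitmx ->
  \det (map_mx intr U *m G *m (map_mx intr U)^T) = \det G.
Proof.
rewrite unitmxE !det_mulmx det_tr det_map_mx => /orP[] /eqP ->; first by rewrite mul1r mulr1.
by rewrite rmorphN1 mulrN1 mulN1r opprK.
Qed.

(** The Smith form of a single row has one invariant factor. This serves to complete a shortest
    vector to a basis. *)
Lemma unimodular_row0 d (b : 'rV[int]_d.+1) :
  exists2 S : 'M[int]_d.+1, S \in unitmx & exists c, b = c *: row 0 S.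
Proof.
have [L uL [S uS [s _ Db]]] := int_Smith_normal_form b.
exists S => //; exists (L 0 0 * s`_0).
have {1}-> : b = L *m (s`_0 *: delta_mx 0 0) *m S.
  rewrite {1}Db; congr (_ *m _ *m _); apply/rowP => i; rewrite !mxE /=.
  by rewrite ?eqxx mulr_natr -(inj_eq val_inj i) [X in _ *+ nat_of_bool X]eq_sym.
rewrite -scalemxAr -scalemxAl [L]mx11_scalar mul_scalar_mx -scalemxAl -rowE.
by rewrite !mxE scalerA mulrC.
Qed.

(** Completion of the square in the first coordinate; the Schur complement is the form projected
    orthogonally to the first basis vector. *)
Lemma quad_schur d (a : R) (b : 'rV[R]_d) (C : 'M[R]_d) (x0 : R) (x : 'rV[R]_d) :
  a != 0 ->
  quad (block_mx a%:M b b^T C) (row_mx x0%:M x) =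
  a * (x0 + (x *m b^T) 0 0 / a) ^+ 2 + quad (C - a^-1 *: (b^T *m b)) x.
Proof.
move=> a0; rewrite /quad mul_row_block tr_row_mx mul_row_col.
have eD (A B : 'M[R]_1) : (A + B) 0 0 = A 0 0 + B 0 0 by rewrite mxE.
have eB (A B : 'M[R]_1) : (A - B) 0 0 = A 0 0 - B 0 0 by rewrite !mxE.
have eZ c (A : 'M[R]_1) : (c *: A) 0 0 = c * A 0 0 by rewrite mxE.
have eN (A : 'M[R]_1) : (- A) 0 0 = - A 0 0 by rewrite mxE.
have eM (A B : 'M[R]_1) : (A *m B) 0 0 = A 0 0 * B 0 0.
  by rewrite [LHS]mxE big_ord1.
have eS c : (c%:M : 'M[R]_1) 0 0 = c by rewrite mxE eqxx mulr1n.
rewrite tr_scalar_mx !mulmxDl !mulmxBr !mulmxBl -!(scalemxAl, scalemxAr).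
rewrite !mul_scalar_mx !mul_mx_scalar -!scalemxAl !(eD, eB, eZ, eS).
rewrite eN eZ [x *m (b^T *m b)]mulmxA -[_ *m b *m x^T]mulmxA eM.
have -> : (b *m x^T) 0 0 = (x *m b^T) 0 0.
  by rewrite -[x *m b^T]trmxK [RHS]mxE trmx_mul trmxK.
by field.
Qed.

Lemma det_schur d (a : R) (b : 'rV[R]_d) (C : 'M[R]_d) : a != 0 ->
  \det (block_mx a%:M b b^T C) = a * \det (C - a^-1 *: (b^T *m b)).
Proof.
move=> a0.
have -> : block_mx a%:M b b^T C =
  block_mx 1%:M 0 (a^-1 *: b^T) 1%:M *m block_mx a%:M b 0 (C - a^-1 *: (b^T *m b)).
  rewrite mulmx_block !mul1mx !mul0mx ?mulmx0 !addr0 mul_mx_scalar scalerA.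
  by rewrite divff // scale1r -scalemxAl addrC subrK.
by rewrite det_mulmx det_lblock det_ublock !det1 !mul1r det_scalar1.
Qed.

Lemma posdef_schur d (a : R) (b : 'rV[R]_d) (C : 'M[R]_d) :
  posdef (block_mx a%:M b b^T C) -> 0 < a /\ posdef (C - a^-1 *: (b^T *m b)).
Proof.
move=> [Gs G0].
have a0 : 0 < a.
  have := G0 (row_mx 1%:M 0).
  rewrite /quad mul_row_block tr_row_mx mul_row_col !mul0mx !addr0 trmx0 mulmx0.
  rewrite addr0 mul1mx tr_scalar_mx mulmx1 mxE eqxx mulr1n; apply.
  by apply/eqP => /matrixP/(_ 0 (lshift d 0))/eqP; rewrite row_mxEl !mxE oner_eq0.
split=> //; split.
  have [_ _ _ CC] : _ := eq_block_mx (etrans (esym (tr_block_mx _ _ _ _)) Gs).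
  by rewrite linearB /= linearZ /= trmx_mul trmxK CC.
(* The first coordinate is chosen to make the completed square vanish. *)
move=> x x0; have := G0 (row_mx (- ((x *m b^T) 0 0 / a))%:M x).
rewrite quad_schur ?gt_eqF // addNr expr0n mulr0 add0r; apply.
by apply: contraNneq x0 => /matrixP H; apply/eqP/rowP => i;
  have := H 0 (rshift 1 i); rewrite row_mxEr !mxE.
Qed.

Lemma round_half (t : R) : exists m : int, (m%:~R + t) ^+ 2 <= 1 / 4.
Proof.
exists (- Num.floor (t + 1 / 2)).
have := floor_itv (t + 1 / 2); rewrite rmorphN intrD /=.
by move: (Num.floor _)%:~R => f /andP[h1 h2]; nra.
Qed.

(* Hermite's argument: a shortest vector [b], completed to a basis, gives a
   Gram matrix with corner [a]; reduce the Schur complement by induction and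
   lift with translates of [b], so that lifted values [X] satisfy both
   [X <= a / 4 + s] and [a <= X], i.e. [X <= 4 / 3 * s]. *)
Lemma hermite_reduction d (G : 'M[R]_d) : posdef G ->
  exists2 U : 'M[int]_d, U \in unitmx &
    \prod_i quad G (row i (map_mx intr U)) <= (4 / 3) ^+ 'C(d, 2) * \det G.
Proof.
elim: d G => [|d IH] G pG.
  by exists 1%:M; rewrite ?unitmx1 // big_ord0 det_mx00 mulr1.
have [b0 b0n b0m] := posdef_int_min pG.
have [S uS [c Db]] := unimodular_row0 b0.
have uSR := map_mx_intr_unit uS.
pose r := row 0 S.
have r0 : r != 0 by apply: contraNneq b0n; rewrite Db -/r => ->; rewrite scaler0.
have c0 : c != 0 by apply: contraNneq b0n => c0; rewrite Db c0 scale0r.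
(* Since [b0 = c *: r] with [c] a nonzero integer, [r] is no longer than [b0] and hence is shortest
   too. *)
have Qr z : z != 0 -> quad G (map_mx intr r) <= quad G (map_mx intr z).
  move=> /b0m; apply: le_trans; rewrite Db map_mxZ.
  rewrite /quad linearZ /= -!scalemxAl -scalemxAr scalerA [leRHS]mxE.
  rewrite ler_peMl ?(quad_ge0 (map_mx intr r) pG) //.
  rewrite -intrM ler1z.
  have : 0 < c * c by rewrite -expr2 exprn_even_gt0.
  by lia.
pose G1 := map_mx intr S *m G *m (map_mx intr S)^T.
have pG1 : posdef G1 by apply: posdef_cong.
have dG1 : \det G1 = \det G by apply: det_intr_cong.
pose H : 'M[R]_(1 + d) := G1.
pose a := G1 0 0.
have DH : H = block_mx a%:M (ursubmx H) (ursubmx H)^T (drsubmx H).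
  rewrite -[LHS]submxK; congr block_mx.
    by rewrite [LHS]mx11_scalar; congr (_%:M); rewrite mxE [LHS]mxE; congr (G1 _ _); apply: val_inj.
  have [Hs _] := pG1.
  by rewrite trmx_ursub; congr dlsubmx; rewrite -[LHS]Hs.
pose b := ursubmx H; pose C := drsubmx H.
have {}DH : G1 = block_mx a%:M b b^T C := DH.
have [a0 pS] : 0 < a /\ posdef (C - a^-1 *: (b^T *m b)).
  by apply: posdef_schur; rewrite -DH.
have [V uV Vle] := IH _ pS.
have Vi i : exists m : int, let x := row_mx (m%:~R : R)%:M (row i (map_mx intr V)) in
    quad G1 x <= 4 / 3 * quad (C - a^-1 *: (b^T *m b)) (row i (map_mx intr V)).
  set x' := row i _.
  have [m hm] := round_half ((x' *m b^T) 0 0 / a); exists m => /=.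
  (* The lift is a nonzero integer vector, so its value is at least the minimum [a]. *)
  have Qa : a <= quad G1 (row_mx (m%:~R : R)%:M x').
    have -> : row_mx (m%:~R : R)%:M x' = map_mx intr (row_mx m%:M (row i V)).
      by rewrite map_row_mx map_scalar_mx map_row.
    have {1}-> : a = quad G (map_mx intr r).
      rewrite /a /G1 quad_row; congr quad; apply/rowP => j; rewrite !mxE //.
    rewrite /G1 quad_cong -map_mxM; apply: Qr.
    apply/eqP => /(congr1 (mulmx^~ (invmx S))); rewrite mul0mx mulmxK //.
    move=> E; have {}E : row_mx m%:M (row i V) = 0 :> 'rV[int]_(1 + d) := E.
    have Vi0 : row i V = 0.
      apply/rowP => j; have /matrixP/(_ 0 (rshift 1 j)) := E.
      by rewrite row_mxEr => ->; rewrite !mxE.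
    have := congr1 (mulmx^~ (invmx V)) Vi0.
    rewrite rowE mulmxK // mul0mx => /matrixP/(_ 0 i).
    by rewrite !mxE !eqxx => /eqP; rewrite oner_eq0.
  have Q1 : quad G1 (row_mx (m%:~R : R)%:M x') =
      quad (block_mx a%:M b b^T C) (row_mx (m%:~R : R)%:M x') by rewrite -DH.
  rewrite Q1 quad_schur ?gt_eqF // in Qa *.
  set s := quad _ _ in Qa *; move: (_ + _) hm Qa => t ht Qa.
  have : a * t ^+ 2 <= a * (1 / 4) by rewrite ler_pM2l.
  by lra.
have [t Ht] := choice Vi.
pose U : 'M[int]_(1 + d) := block_mx 1%:M 0 (\col_i t i) V.
have uU : U \in unitmx.
  by rewrite unitmxE det_lblock det1 mul1r -unitmxE.
exists (U *m S); first by rewrite unitmx_mul uU.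
have QU i : quad G (row i (map_mx intr (U *m S))) = quad G1 (row i (map_mx intr U)).
  by rewrite map_mxM row_mul /G1 quad_cong.
rewrite (eq_bigr _ (fun i _ => QU i)).
rewrite -dG1 [in leRHS]DH det_schur ?gt_eqF //.
rewrite big_ord_recl /=.
have rowU0 : row (lshift d 0) U = row_mx 1%:M 0.
  by rewrite /U block_mxEv rowKu row_id.
have rowU1 i : row (rshift 1 i) U = row_mx (t i)%:M (row i V).
  rewrite /U block_mxEv rowKd row_row_mx; congr row_mx.
  by apply/rowP => j; rewrite !mxE (ord1 j) eqxx mulr1n.
have -> : quad G1 (row ord0 (map_mx intr U)) = a.
  pose E0 : 'rV[R]_(1 + d) := row_mx 1%:M 0.
  have E0E : row ord0 (map_mx intr U) = E0.
    have -> : ord0 = lshift d (0 : 'I_1) by apply: val_inj.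
    by rewrite -map_row [row _ U]rowU0 map_row_mx map_mx1 map_mx0.
  rewrite E0E DH quad_schur ?gt_eqF //.
  by rewrite mul0mx mxE mul0r addr0 expr1n mulr1 /quad !mul0mx mxE addr0.
have rowU i : row (lift ord0 i) (map_mx intr U) = row_mx ((t i)%:~R : R)%:M (row i (map_mx intr V)).
  have -> : lift ord0 i = rshift 1 i by apply: val_inj.
  by rewrite -map_row [row _ U]rowU1 map_row_mx map_row map_scalar_mx.
rewrite mulrCA ler_pM2l //.
apply: (@le_trans _ _ (\prod_(i < d) (4 / 3 *
    quad (C - a^-1 *: (b^T *m b)) (row i (map_mx intr V))))).
  apply: ler_prod => i _; apply/andP; split; first exact: quad_ge0.
  by rewrite rowU; exact: Ht.
(* The [d] new factors 4/3 account for ['C(d.+1, 2) = 'C(d, 2) + d]. *)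
rewrite big_split /= prodr_const card_ord binS bin1 exprD -mulrA.
rewrite [leRHS]mulrCA ler_pM2l; first exact: Vle.
by rewrite exprn_gt0 // divr_gt0.
Qed.

End Hermite.

(** * Lattices in the space of embeddings *)

Section RowReplace.
Variables (K : comNzRingType) (d : nat).

Definition repl_row (M : 'M[K]_d) j (z : 'rV[K]_d) : 'M[K]_d :=
  \matrix_(i, k) if i == j then z 0 k else M i k.

(** Cramer's rule in adjugate form: this is [\det M] times the coordinate of [z] along row [j], and
    it stays integral. *)
Lemma det_repl_row M j z : \det (repl_row M j z) = (z *m \adj M) 0 j.
Proof.
rewrite (expand_det_row _ j) mxE; apply: eq_bigr => k _.
rewrite !mxE eqxx; congr (_ * _); rewrite /cofactor; congr (_ * \det _).
by apply/matrixP => u v; rewrite !mxE eq_sym (negPf (neq_lift _ _)).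
Qed.

Lemma repl_row_id M j : repl_row M j (row j M) = M.
Proof. by apply/matrixP => i k; rewrite !mxE; case: eqP => [->|]. Qed.
End RowReplace.

Section Lattice.
Variables (R : realType) (d : nat) (W : 'M[R[i]]_d).
Implicit Types (z : 'rV[int]_d) (i : 'I_d).

(** Row [i] of [W] holds the [i]-th embedding of a basis; this is the embedding of the lattice point
    with coordinates [z]. *)
Definition emb z i : R[i] := \sum_j (z 0 j)%:~R * W i j.

Lemma embD z1 z2 i : emb (z1 + z2) i = emb z1 i + emb z2 i.
Proof.
by rewrite /emb -big_split; apply: eq_bigr => j _; rewrite mxE intrD mulrDl.
Qed.

Lemma embN z i : emb (- z) i = - emb z i.
Proof.
by rewrite /emb -sumrN; apply: eq_bigr => j _; rewrite mxE intrN mulNr.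
Qed.

Lemma embB z1 z2 i : emb (z1 - z2) i = emb z1 i - emb z2 i.
Proof. by rewrite embD embN. Qed.

Lemma emb0 i : emb 0 i = 0.
Proof. by rewrite /emb big1 // => j _; rewrite mxE mul0r. Qed.

Lemma emb_sum (I : Type) (r : seq I) (P : pred I) (F : I -> 'rV_d) i :
  emb (\sum_(k <- r | P k) F k) i = \sum_(k <- r | P k) emb (F k) i.
Proof. by elim/big_rec2: _ => [|k y1 y2 _ <-]; rewrite ?emb0 ?embD. Qed.

Lemma embE z i : emb z i = (map_mx intr z *m W^T) 0 i.
Proof. by rewrite mxE; apply: eq_bigr => j _; rewrite !mxE. Qed.

Variables (a : 'I_d -> R) (r : R).
Hypotheses (a0 : forall i, 0 < a i) (r0 : 0 < r).
Hypothesis cov : forall (t : R) z,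
  exists z', forall i, a i * absC ((t%:C)%C * emb z i - emb z' i) <= r.

(* Differences of lattice points close to the multiples [(j / k) z]. *)
Lemma split_lattice z k : (0 < k)%N ->
  exists y : 'I_k -> 'rV[int]_d, z = \sum_j y j /\
    forall j i, a i * absC (emb (y j) i - ((k%:R^-1)%:C)%C * emb z i) <= 2 * r.
Proof.
move=> k0; have [p Hp] := choice (fun j : nat => cov (j%:R / k%:R) z).
have kn0 : k%:R != 0 :> R by rewrite pnatr_eq0 -lt0n.
(* The end points are taken exactly, so that the differences telescope to [z]. *)
pose q j := if j == 0%N then 0 else if j == k then z else p j.
have Hq j i : a i * absC (((j%:R / k%:R)%:C)%C * emb z i - emb (q j) i) <= r.
  rewrite /q; case: eqP => [->|_]; first by rewrite !mul0r emb0 subrr absC0 mulr0 ltW.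
  case: eqP => [->|_]; last exact: Hp.
  by rewrite divff // mul1r subrr absC0 mulr0 ltW.
exists (fun j => q j.+1 - q j); split.
  rewrite -(big_mkord xpredT (fun j => q j.+1 - q j)) telescope_sumr //.
  by rewrite /q /= eqxx (gtn_eqF k0) subr0.
move=> j i; rewrite embB.
set e := _ - _ * _.
have -> : e = (((j%:R / k%:R)%:C)%C * emb z i - emb (q j) i) -
  (((j.+1%:R / k%:R)%:C)%C * emb z i - emb (q j.+1) i).
  rewrite /e -[j.+1]addn1 natrD mulrDl rmorphD /= mul1r; ring.
rewrite (le_trans (ler_wpM2l (ltW (a0 i)) (absCD _ _))) // absCN mulrDr.
by rewrite mulrDl mul1r lerD.
Qed.

(** Each piece is within [2 * r] of [z / k], itself of size at most [r]; hence the radius [3 * r] of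
    [in_ball]. *)
Lemma split_ball z k : (0 < k)%N -> (forall i, a i * absC (emb z i) <= k%:R * r) ->
  exists y : 'I_k -> 'rV[int]_d, z = \sum_j y j /\
    forall j i, a i * absC (emb (y j) i) <= 3 * r.
Proof.
move=> k0 zk; have [y [Dz Hy]] := split_lattice z k0; exists y; split=> // j i.
have kp : 0 < k%:R :> R by rewrite ltr0n.
have := Hy j i; set c := ((k%:R^-1)%:C)%C => h.
rewrite -[emb (y j) i](subrK (c * emb z i)).
rewrite (le_trans (ler_wpM2l (ltW (a0 i)) (absCD _ _))) // mulrDr.
have : a i * absC (c * emb z i) <= r.
  rewrite absCM absC_real ger0_norm ?invr_ge0 ?ler0n //.
  by rewrite mulrCA mulrC ler_pdivrMr // [leRHS]mulrC.
by lra.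
Qed.

Definition in_ball (M : 'M[int]_d) i := forall k, a k * absC (emb (row i M) k) <= 3 * r.

(** Exchange: the rows of the identity are replaced one by one. A row is cut into ball vectors, and
    since the determinant is additive in it, some piece keeps the determinant nonzero. *)
Lemma ball_independent : exists M, \det M != 0 /\ forall i, in_ball M i.
Proof.
suff H n : (n <= d)%N -> exists M, \det M != 0 /\ forall i, (i < n)%N -> in_ball M i.
  by have [M [? Mb]] := H d (leqnn d); exists M; split=> // i; apply: Mb.
elim: n => [_|n IH nd]; first by exists 1%:M; rewrite det1.
have [M [dM Mb]] := IH (ltnW nd); pose j0 := Ordinal nd.
pose S := \sum_i a i * absC (emb (row j0 M) i) / r.
have S0 : 0 <= S.
  by apply: sumr_ge0 => i _; rewrite !mulr_ge0 ?invr_ge0 ?absC_ge0 // ltW.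
have k0 : (0 < Num.bound S)%N.
  by rewrite -(ltr_nat R) (le_lt_trans S0) // archi_boundP.
have [] := split_ball (z := row j0 M) k0.
  move=> i; rewrite -ler_pdivrMr //; apply: le_trans (ltW (archi_boundP S0)).
  rewrite /S (bigD1 i) //= lerDl; apply: sumr_ge0 => k _.
  by rewrite !mulr_ge0 ?invr_ge0 ?absC_ge0 // ltW.
move=> y [Dy Hy].
have [k yk] : exists k, (y k *m \adj M) 0 j0 != 0.
  apply/existsP; apply: contraNT dM; rewrite negb_exists => /forallP H.
  rewrite -[M](repl_row_id _ j0) det_repl_row Dy mulmx_suml summxE big1 //.
  by move=> k _; apply/eqP; have := H k; rewrite negbK.
exists (repl_row M j0 (y k)); rewrite det_repl_row; split=> // i.
have [-> _ l|ij] := eqVneq i j0.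
  have -> : row j0 (repl_row M j0 (y k)) = y k.
    by apply/rowP => l'; rewrite !mxE eqxx.
  exact: Hy.
rewrite ltnS leq_eqVlt => /orP[/eqP ni|/Mb Mi l].
  by case/eqP: ij; apply: val_inj.
have -> : row i (repl_row M j0 (y k)) = row i M by apply/rowP => l'; rewrite !mxE (negPf ij).
exact: Mi.
Qed.

(** Column [i] of the matrix of embeddings is bounded by [3 * r / a i]. This controls the index
    [|\det M|] of the sublattice spanned by the rows. *)
Lemma det_ball_le M : (forall i, in_ball M i) ->
  `|(\det M)%:~R| * absC (\det W) * \prod_i a i <= d`!%:R * (3 * r) ^+ d.
Proof.
move=> Mb.
have -> : `|(\det M)%:~R| * absC (\det W) = absC (\det (map_mx intr M *m W^T)).
  by rewrite det_mulmx det_tr absCM det_map_mx absC_int intr_norm.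
have pa : 0 < \prod_i a i by apply: prodr_gt0.
rewrite -ler_pdivlMr // -mulrA.
have -> : (3 * r) ^+ d / \prod_i a i = \prod_i (3 * r / a i).
  by rewrite big_split /= prodr_const card_ord prodfV.
apply: det_absC_le => i j; rewrite ler_pdivlMr // mulrC.
have := Mb i j; rewrite embE.
suff -> : (map_mx intr (row i M) *m W^T) 0 j = (map_mx intr M *m W^T) i j by [].
by move=> *; rewrite map_row -row_mul mxE.
Qed.

(* [M] has maximal [|det|] among the tuples taken in the ball, so that by
   Cramer's rule ball vectors have coordinates at most 1 in its rows. *)
Lemma ball_basis : \det W != 0 -> exists M, [/\ \det M != 0, forall i, in_ball M i &
  forall z k, (0 < k)%N -> (forall i, a i * absC (emb z i) <= k%:R * r) ->
    forall j, `|(z *m \adj M) 0 j| <= k%:Z * `|\det M|].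
Proof.
move=> dW.
pose P n := `[< exists M, (forall i, in_ball M i) /\ `|\det M|%N = n >].
have [M0 [dM0 M0b]] := ball_independent.
have P0 : P `|\det M0|%N by apply/asboolP; exists M0.
have exP : exists n, P n by exists `|\det M0|%N.
pose C := d`!%:R * (3 * r) ^+ d / (absC (\det W) * \prod_i a i).
have pa : 0 < \prod_i a i by apply: prodr_gt0.
have cp : 0 < absC (\det W) * \prod_i a i.
  by rewrite mulr_gt0 // lt_def absC_eq0 dW absC_ge0.
have ubP n : P n -> (n <= Num.bound C)%N.
  move=> /asboolP [M [Mb <-]]; rewrite -(ler_nat R) ltW //.
  have H : (`|\det M|%N)%:R <= C.
    by rewrite /C ler_pdivlMr // mulrA pmulrn abszE intr_norm det_ball_le.
  by apply: (le_lt_trans H (archi_boundP _)); apply: le_trans H; rewrite ler0n.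
case: (ex_maxnP exP ubP) => n /asboolP [M [Mb Dn]] maxn.
exists M; split => //.
  by rewrite -absz_gt0 Dn (leq_trans _ (maxn _ P0)) // absz_gt0.
move=> z k k0 zk j; have [y [-> Hy]] := split_ball k0 zk.
rewrite mulmx_suml summxE (le_trans (ler_norm_sum _ _ _)) //.
have -> : k%:Z * `|\det M| = \sum_(i < k) `|\det M|.
  by rewrite sumr_const card_ord -mulr_natl; congr (_ * _); rewrite pmulrn intz.
apply: ler_sum => i _; rewrite -det_repl_row -!abszE lez_nat Dn.
apply: maxn; apply/asboolP; exists (repl_row M j (y i)); split=> // l.
have [->|lj] := eqVneq l j => k'.
  have -> : row j (repl_row M j (y i)) = y i by apply/rowP => l'; rewrite !mxE eqxx.
  exact: Hy.
have -> : row l (repl_row M j (y i)) = row l M by apply/rowP => l'; rewrite !mxE (negPf lj).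
exact: Mb.
Qed.
End Lattice.

Lemma finite_of_inj (T : eqType) (F : finType) (S : T -> Prop) (f : T -> F) :
  (forall x y, S x -> S y -> f x = f y -> x = y) ->
  exists s : seq T, [/\ uniq s, forall x, x \in s <-> S x & (size s <= #|F|)%N].
Proof.
move=> finj; pose D := [pred u | `[< exists x, S x /\ f x = u >]].
have [[x0 Sx0]|noS] := pselect (exists x, S x); last first.
  exists [::]; split=> // x; split=> // Sx; case: noS; by exists x.
have [g Hg] := choice (fun u => let: p := pselect (exists x, S x /\ f x = u) in
  match p with
  | left h => let: ex_intro x hx := h in
     ex_intro (fun x => D u -> S x /\ f x = u) x (fun _ => hx)
  | right h => ex_intro (fun x => D u -> S x /\ f x = u) x0
     (fun hD => False_ind _ (h (asboolW hD)))
  end).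
exists [seq g u | u <- enum D]; split.
- rewrite map_inj_in_uniq ?enum_uniq // => u v.
  rewrite !mem_enum => /Hg [_ gu] /Hg [_ gv] E.
  by rewrite -gu -gv E.
- move=> x; split=> [/mapP [u]|Sx].
    by rewrite mem_enum => /Hg [Sg _] ->.
  have Dx : D (f x) by apply/asboolP; exists x.
  apply/mapP; exists (f x); rewrite ?mem_enum //.
  by have [Sg gx] := Hg _ Dx; apply: finj.
- by rewrite size_map -cardE max_card.
Qed.

(** * Counting lattice points in a ball *)

Section Count.
Variables (R : realType) (d : nat) (W : 'M[R[i]]_d) (a : 'I_d -> R) (r : R).
Hypotheses (a0 : forall i, 0 < a i) (r0 : 0 < r) (dW : \det W != 0).
Hypothesis cov : forall (t : R) z,
  exists z', forall i, a i * absC ((t%:C)%C * emb W z i - emb W z' i) <= r.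

(* A ball point is determined by its class modulo the rows of [M] and the
   integer parts of its coordinates in these rows. *)
Lemma count_ball (S : 'rV[int]_d -> Prop) k : (0 < k)%N ->
  (forall z, S z -> forall i, a i * absC (emb W z i) <= k%:R * r) ->
  exists s : seq 'rV[int]_d, [/\ uniq s, forall z, z \in s <-> S z &
    (size s)%:R * absC (\det W) * \prod_i a i
      <= (2 * k + 1)%:R ^+ d * (d`!%:R * (3 * r) ^+ d)].
Proof.
move=> k0 Sk; have [M [dM Mb Mk]] := ball_basis a0 r0 cov dW.
have [Q [cl [cardQ clP]]] := det_int_classes dM.
(* Integer part of the [j]-th coordinate of [z] in the rows of [M]; below it is shifted by [k] into
   the range from 0 to [2 * k]. *)
pose q (z : 'rV[int]_d) j := divz ((z *m \adj M) 0 j) (\det M).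
have qk z j : S z -> `|q z j| <= k%:Z.
  move=> /Sk /(Mk _ _ k0) /(_ j); rewrite /q; move: ((z *m \adj M) 0 j) => x.
  have := divz_eq x (\det M); have := ltz_mod x dM; have := modz_ge0 x dM.
  move: (\det M) (divz x _) (modz x _) => D e m.
  by move=> h1 h2 h3 h4; nia.
pose f z : {ffun 'I_d -> 'I_(2 * k).+1} * Q :=
  ([ffun j => inord (absz (q z j + k%:Z)%R)], cl z).
have [x y Sx Sy [/ffunP fxy cxy]|s [us sS ss]] := finite_of_inj (S := S) (f := f).
  have [u xy] := clP _ _ cxy.
  (* Coordinates with the same integer part differ by less than 1, so their integer difference
     [u 0 j] is 0. *)
  have Eu j : u 0 j = 0.
    have qq : q x j = q y j.
      have := congr1 val (fxy j); rewrite !ffunE /=.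
      have := qk x j Sx; have := qk y j Sy; move: (q x j) (q y j) => A B hB hA.
      by rewrite !inordK; lia.
    have E : (x *m \adj M) 0 j - (y *m \adj M) 0 j = u 0 j * \det M.
      have : ((x - y) *m \adj M) 0 j = (u *m (M *m \adj M)) 0 j by rewrite xy mulmxA.
      by rewrite mul_mx_adj mul_mx_scalar mulmxBl !mxE mulrC.
    move: E; rewrite (divz_eq ((x *m \adj M) 0 j) (\det M)).
    rewrite (divz_eq ((y *m \adj M) 0 j) (\det M)) -/(q x j) -/(q y j) qq.
    have := ltz_mod ((x *m \adj M) 0 j) dM; have := modz_ge0 ((x *m \adj M) 0 j) dM.
    have := ltz_mod ((y *m \adj M) 0 j) dM; have := modz_ge0 ((y *m \adj M) 0 j) dM.
    move: (\det M) (q y j) (modz ((x *m _) _ _) _) (modz _ _) (u 0 j).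
    by move=> D e m1 m2 v h1 h2 h3 h4 h5; nia.
  apply/eqP; rewrite -subr_eq0 xy; apply/eqP.
  by rewrite (_ : u = 0) ?mul0mx //; apply/rowP => j; rewrite Eu mxE.
exists s; split=> //.
have := det_ball_le a0 Mb.
have pa : 0 <= \prod_i a i by rewrite ltW // prodr_gt0.
have sz : (size s)%:R <= (2 * k + 1)%:R ^+ d * `|(\det M)%:~R : R|.
  apply: (@le_trans _ _ ((#|{ffun 'I_d -> 'I_(2 * k).+1}| * #|Q|)%:R)).
    by rewrite ler_nat -card_prod.
  rewrite card_ffun !card_ord cardQ natrM natrX addn1.
  by rewrite [X in _ * X]pmulrn abszE intr_norm.
move=> H; apply: le_trans (ler_wpM2l _ H); last by rewrite exprn_ge0 ?ler0n.
by rewrite !mulrA -!(mulrA _ _ (\prod_i _)) !(mulrA _ (absC _)) ler_wpM2r // ler_wpM2r ?absC_ge0.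
Qed.
End Count.

(** * The cone construction *)

(** Converts a decomposition into a list of states to a matrix row of multiplicities. *)
Lemma sum_count_seq_sub (K : pzSemiRingType) (T : choiceType) (s L : seq T) (F : T -> K) :
  {subset L <= s} ->
  \sum_(t : seq_sub s) (count_mem (val t) L)%:R * F (val t) = \sum_(u <- L) F u.
Proof.
elim: L => [|u L IH] Ls; first by rewrite big_nil big1 // => t _; rewrite mul0r.
rewrite big_cons -IH => [|v vL]; last by apply: Ls; rewrite inE vL orbT.
under eq_bigr do rewrite natrD mulrDl.
rewrite big_split; congr (_ + _).
have us : u \in s by apply: Ls; rewrite mem_head.
rewrite (bigD1 (SeqSub us)) //= eqxx mul1r big1 ?addr0 // => t tu.
suff /negPf -> : u != val t by rewrite mul0r.
by apply: contra tu => /eqP ut; apply/eqP/val_inj.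
Qed.

Section Cone.
Variables (R : realType) (d : nat) (W : 'M[R[i]]_d) (a : 'I_d -> R) (r : R).
Hypotheses (a0 : forall i, 0 < a i) (r0 : 0 < r) (dW : \det W != 0).
Hypothesis cov : forall (t : R) z,
  exists z', forall i, a i * absC ((t%:C)%C * emb W z i - emb W z' i) <= r.
Variables (i0 : 'I_d) (Lam : 'rV[int]_d -> 'rV[int]_d) (lam : 'I_d -> R[i]) (l rho : R).
Hypotheses (LamE : forall z i, emb W (Lam z) i = lam i * emb W z i)
  (lam0 : lam i0 = (l%:C)%C)
  (lamle : forall i, i != i0 -> absC (lam i) <= rho * l)
  (emb_real : forall z, emb W z i0 = ((complex.Re (emb W z i0))%:C)%C)
  (rho0 : 0 <= rho) (rho1 : rho < 1) (l_gt : 1 + 4 / (1 - rho) < l).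
Hypothesis axis : forall t : R, exists z, forall i,
  a i * absC ((if i == i0 then (t%:C)%C else 0) - emb W z i) <= r.

Variables (eps h1 : R).
Hypotheses (epsE : eps = 1 - rho) (eh1 : eps * h1 = 8 * r).
Let H z := a i0 * complex.Re (emb W z i0).
(** Slice of the cone. Pieces have height between [h1 + 2 * r] and twice that before rounding, and
    rounding moves heights by at most [2 * r]. *)
Let S z := h1 <= H z <= 2 * h1 + 6 * r /\ forall i, a i * absC (emb W z i) <= H z.

Let eps0 : 0 < eps. Proof. by rewrite epsE subr_gt0. Qed.
Let eps1 : eps <= 1. Proof. by rewrite epsE gerBl. Qed.
Let h1r : 8 * r <= h1.
Proof.
by rewrite -eh1 ler_piMl // -(pmulr_rge0 _ eps0) eh1 mulr_ge0 // ltW.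
Qed.

Let Habs z : 0 <= H z -> a i0 * absC (emb W z i0) = H z.
Proof.
move=> Hz; rewrite emb_real absC_real ger0_norm //.
by rewrite -(pmulr_rge0 _ (a0 i0)).
Qed.

Let HB z1 z2 : H (z1 - z2) = H z1 - H z2.
Proof. by rewrite /H embB ReB mulrBr. Qed.

Let HLam z : H (Lam z) = l * H z.
Proof. by rewrite /H LamE lam0 Re_realM mulrCA. Qed.

Let H_sum (I : Type) (s : seq I) (F : I -> 'rV_d) :
  H (\sum_(u <- s) F u) = \sum_(u <- s) H (F u).
Proof. by rewrite /H emb_sum Re_sum mulr_sumr. Qed.

Let Sb : exists b, [/\ S b, H b <= h1 + 2 * r &
  forall i, i != i0 -> a i * absC (emb W b i) <= r].
Proof.
(* The target height [h1 + r] leaves room for an error [r] on either side. *)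
have [b Hb] := axis ((h1 + r) / a i0); exists b.
have Hb1 : `|h1 + r - H b| <= r.
  have := Hb i0; rewrite eqxx => h; apply: le_trans h.
  rewrite emb_real -rmorphB /= absC_real -[X in X * _]gtr0_norm // -normrM.
  by rewrite mulrBr mulrCA divff ?mulr1 // gt_eqF.
have Hb2 i : i != i0 -> a i * absC (emb W b i) <= r.
  by move=> ii0; have := Hb i; rewrite (negPf ii0) sub0r absCN.
move: Hb1; rewrite ler_norml => /andP[u1 u2]; have h1r' := h1r.
split=> //; last by lra.
split=> [|i]; first by apply/andP; split; lra.
have [->|/Hb2 h] := eqVneq i i0; first by rewrite Habs //; lra.
by lra.
Qed.

(** Contraction by [rho] leaves a gap of about [eps * X] between [Lam y] and the boundary of the
    cone; it absorbs both the subtraction of [b] and the rounding of the [k] pieces. *)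
Let row_decomposition b y : S b -> H b <= h1 + 2 * r ->
    (forall i, i != i0 -> a i * absC (emb W b i) <= r) -> S y ->
  exists L : seq 'rV[int]_d, [/\ b \in L, forall u, u \in L -> S u &
    \sum_(u <- L) u = Lam y].
Proof.
move=> bS Hb bi [/andP[y1 y2] yi]; have [/andP[b1 _] _] := bS.
pose z := Lam y - b; pose X := l * H y; have h1r' := h1r; have eh1' := eh1.
have Hz : H z = X - H b by rewrite HB HLam.
have l_gt' := l_gt; rewrite -epsE in l_gt'.
have l0 : 0 < l by apply: lt_trans l_gt'; rewrite ltr_pwDl // divr_ge0 // ltW.
(* Here the threshold on [l] enters: [X] is large enough to remain high after [b] is removed. *)
have hX : (1 + 4 / eps) * h1 <= X.
  apply: (@le_trans _ _ (l * h1)); last by rewrite ler_pM2l.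
  by rewrite ler_wpM2r ?(ltW l_gt') //; lra.
have eX : eps * h1 + 4 * h1 <= eps * X.
  rewrite -(ler_pM2l eps0) in hX; apply: le_trans hX.
  suff -> : eps * ((1 + 4 / eps) * h1) = eps * h1 + 4 * h1 by [].
  by field; rewrite gt_eqF.
have X5 : 5 * h1 <= X.
  apply: le_trans hX; rewrite ler_wpM2r //; first by lra.
  suff : 4 <= 4 / eps by lra.
  by rewrite ler_pdivlMr // ler_piMr.
pose hs := h1 + 2 * r; have hs0 : 0 < hs.
  have h10 : 0 < h1 by apply: lt_le_trans h1r; rewrite mulr_gt0.
  by rewrite addr_gt0 ?mulr_gt0.
(* Truncation puts the height of [z / k] between [hs] and [2 * hs]. *)
pose k := Num.truncn (H z / hs).
have /andP[k1 k2] : k%:R <= H z / hs < k.+1%:R.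
  by apply: truncn_itv; rewrite divr_ge0 ?(ltW hs0) // Hz; lra.
rewrite ler_pdivlMr // in k1; rewrite ltr_pdivrMr // -natr1 in k2.
have k0 : (0 < k)%N.
  by rewrite lt0n; apply: contraTneq k2 => ->; rewrite -leNgt add0r mul1r Hz /hs; lra.
have kp : 1 <= k%:R :> R by rewrite ler1n.
have [u [Du Hu]] := split_lattice a0 r0 cov z k0.
exists (b :: [seq u j | j <- enum 'I_k]); split; first exact: mem_head.
  move=> v; rewrite inE => /orP[/eqP -> //|/mapP [j _ ->]].
  have kz : hs <= H z / k%:R <= 2 * hs.
    by rewrite ler_pdivlMr ?ler_pdivrMr ?(lt_le_trans ltr01) //; apply/andP; split; nra.
  have Huj : `|H (u j) - H z / k%:R| <= 2 * r.
    have := Hu j i0; rewrite (emb_real (u j)) (emb_real z) -rmorphM -rmorphB /=.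
    rewrite absC_real -[X in X * _]gtr0_norm // -normrM => h.
    by apply: le_trans h; rewrite le_eqVlt /H mulrBr [k%:R^-1 * _]mulrC mulrA eqxx.
  move: Huj; rewrite ler_norml => /andP[j1 j2].
  split; first by apply/andP; split; rewrite /hs in kz; lra.
  move=> i; have [->|ii0] := eqVneq i i0.
    by rewrite Habs // (le_trans _ (_ : h1 <= _)) //; rewrite /hs in kz; lra.
  have zi : a i * absC (emb W z i) <= rho * X + r.
    rewrite embB LamE (le_trans (ler_wpM2l (ltW (a0 i)) (absCD _ _))) //.
    rewrite absCN mulrDr lerD ?bi // absCM mulrCA.
    apply: (@le_trans _ _ (rho * l * (a i * absC (emb W y i)))).
      by rewrite ler_wpM2r ?lamle // mulr_ge0 ?absC_ge0 // ltW.
    by rewrite /X [rho * (l * _)]mulrA ler_wpM2l // mulr_ge0 // ltW.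
  (* The term [4 * r] covers [2 * r] for component [i] and [2 * r] for the height. Half of [eps * X]
     pays for it, by [eps * h1 = 8 * r] and [k * h1 <= X]; the other half pays for [H b + r]. *)
  have key : (rho * X + r) / k%:R + 4 * r <= H z / k%:R.
    rewrite -lerBrDl -mulrBl ler_pdivlMr ?(lt_le_trans ltr01) //.
    have e1 : rho = 1 - eps by rewrite epsE opprB addrC subrK.
    have e2 : k%:R * h1 <= X by rewrite /hs in k1; nra.
    have e3 : 8 * (r * k%:R) <= eps * X.
      by rewrite mulrA -eh1 -mulrA ler_pM2l // mulrC.
    by rewrite Hz e1; nra.
  have := Hu j i; set c := ((k%:R^-1)%:C)%C => h.
  rewrite -[emb W (u j) i](subrK (c * emb W z i)).
  rewrite (le_trans (ler_wpM2l (ltW (a0 i)) (absCD _ _))) // mulrDr.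
  have : a i * absC (c * emb W z i) <= (rho * X + r) / k%:R.
    rewrite absCM absC_real ger0_norm ?invr_ge0 ?ler0n //.
    by rewrite mulrCA mulrC ler_wpM2r ?invr_ge0 ?ler0n.
  by lra.
by rewrite big_cons big_map big_enum /= -Du addrC subrK.
Qed.

Lemma cone_realizable_scaled : exists2 n, pf_realizable (l%:C)%C n &
  n%:R * absC (\det W) * \prod_i a i <= (47 / (1 - rho)) ^+ d * (d`!%:R * (3 * r) ^+ d).
Proof.
have [b [Sb1 Hb bi]] := Sb.
(* Heights in [S] are at most [2 * h1 + 6 * r <= 22 * r / eps], and then
   [2 * k + 1 <= 44 / eps + 3 <= 47 / eps]. *)
pose k := (Num.truncn (22 / eps)).+1.
have /andP[k1 k2] : (Num.truncn (22 / eps))%:R <= 22 / eps < k%:R.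
  by apply: truncn_itv; rewrite divr_ge0 // ltW.
have Sk z : S z -> forall i, a i * absC (emb W z i) <= k%:R * r.
  move=> [/andP[_ z2] zi] i; apply: (le_trans (zi i)); apply: (le_trans z2).
  apply: (@le_trans _ _ (22 / eps * r)); last by rewrite ler_pM2r // ltW.
  have -> : 22 / eps * r = 2 * h1 + 6 * (r / eps).
    have -> : h1 = 8 * r / eps by rewrite -eh1 mulrAC divff ?mul1r // gt_eqF.
    by field; rewrite gt_eqF.
  by rewrite lerD2l ler_pM2l // ler_pdivlMr // ler_piMr // ltW.
have [//|s [us sS ss]] := count_ball a0 r0 dW cov (k := k) _ Sk.
have bs : b \in s by apply/sS.
have Ldec (t : seq_sub s) : exists L : seq 'rV[int]_d,
   [/\ b \in L, {subset L <= s} & \sum_(u <- L) u = Lam (val t)].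
  have St : S (val t) by apply/sS; exact: valP.
  have [L [bL LS DL]] := row_decomposition Sb1 Hb bi St.
  by exists L; split=> // u /LS /sS.
have [L HL] := choice Ldec.
(* Multiplicities in the decomposition of [Lam t]. As [H] is additive and [Lam] scales it by [l],
   the heights form the eigenvector. *)
pose A (t t' : seq_sub s) := count_mem (val t') (L t).
have Ab t : (0 < A t (SeqSub bs))%N.
  by have [bL _ _] := HL t; rewrite -has_count has_pred1.
have [t|t|n ns Hn] := realizable_of_eigenvector Ab (v := fun t => H (val t)) (l := l).
- have /sS [/andP[t1 _] _] := valP t; apply: lt_le_trans t1.
  by apply: lt_le_trans h1r; rewrite mulr_gt0.
- have [_ Ls DL] := HL t.
  by rewrite -HLam -DL H_sum /A -(sum_count_seq_sub H Ls).
- exists n => //; apply: (@le_trans _ _ ((size s)%:R * absC (\det W) * \prod_i a i)).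
    rewrite ler_wpM2r //; first by rewrite ltW // prodr_gt0.
    rewrite ler_wpM2r ?absC_ge0 // ler_nat.
    by apply: leq_trans ns _; rewrite card_seq_sub.
  apply: le_trans ss _; rewrite ler_wpM2r ?mulr_ge0 ?exprn_ge0 ?ler0n ?mulr_ge0 ?(ltW r0) //.
  rewrite -epsE ler_pXn2r ?nnegrE ?ler0n ?divr_ge0 ?(ltW eps0) //.
  rewrite ler_pdivlMr //.
  move: k1; rewrite ler_pdivlMr // natrD natrM /k.
  move: (Num.truncn _) => t k1; rewrite -[t.+1%:R]natr1.
  have := eps1; move: k1; move: (t%:R : R) eps => u e h1' h2'; by nra.
  exact: leq_ltn_trans (ltn_ord i0).
Qed.
End Cone.

Lemma cone_realizable (R : realType) d (W : 'M[R[i]]_d) (a : 'I_d -> R) (r : R)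
    (i0 : 'I_d) (Lam : 'rV[int]_d -> 'rV[int]_d) (lam : 'I_d -> R[i]) (l rho : R) :
  (forall i, 0 < a i) -> 0 < r -> \det W != 0 ->
  (forall (t : R) z, exists z', forall i,
    a i * absC ((t%:C)%C * emb W z i - emb W z' i) <= r) ->
  (forall t : R, exists z, forall i,
    a i * absC ((if i == i0 then (t%:C)%C else 0) - emb W z i) <= r) ->
  (forall z i, emb W (Lam z) i = lam i * emb W z i) ->
  lam i0 = (l%:C)%C -> (forall i, i != i0 -> absC (lam i) <= rho * l) ->
  (forall z, emb W z i0 = ((complex.Re (emb W z i0))%:C)%C) ->
  0 <= rho -> rho < 1 -> 1 + 4 / (1 - rho) < l ->
  exists2 n, pf_realizable (l%:C)%C n &
    n%:R * absC (\det W) * \prod_i a i <= (47 / (1 - rho)) ^+ d * (d`!%:R * (3 * r) ^+ d).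
Proof.
move=> a0 r0 dW cov axis LamE lam0 lamle er rho0 rho1 lgt.
have e : (1 - rho) * (8 * r / (1 - rho)) = 8 * r.
  by rewrite mulrC divfK // subr_eq0 gt_eqF.
exact: (cone_realizable_scaled a0 r0 dW cov LamE lam0 lamle er rho0 rho1 lgt axis erefl e).
Qed.

(** * Covering radius and short products *)

Section Transference.
Variables (R : realType) (d : nat) (W : 'M[R[i]]_d).
Hypothesis dW : \det W != 0.

Lemma emb_row (V : 'M[int]_d) j i :
  emb W (row j V) i = (map_mx intr V *m W^T) j i.
Proof. by rewrite embE map_row -row_mul [LHS]mxE. Qed.

(* Round the coordinates of [x] in the rows of [V]; these are real because the
   conjugate coordinates solve the same linear system. *)
Lemma cov_of_independent (s : 'I_d -> 'I_d) (V : 'M[int]_d) (c : R) :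
  involutive s -> (forall i j, W (s i) j = (W i j)^*) -> \det V != 0 ->
  (forall i j, absC (emb W (row j V) i) <= c) ->
  forall x : 'I_d -> R[i], (forall i, x (s i) = (x i)^*) ->
    exists z, forall i, absC (x i - emb W z i) <= d%:R * c.
Proof.
move=> ss Ws dV Vc x xs.
pose B := map_mx (intr : int -> R[i]) V *m W^T.
have uB : B \in unitmx.
  by rewrite unitmxE det_mulmx det_tr unitfE mulf_neq0 // det_map_mx intr_eq0.
pose t := (\row_i x i) *m invmx B.
have tB : t *m B = \row_i x i by rewrite mulmxKV.
have Bs j i : B j (s i) = (B j i)^*.
  rewrite /B -!emb_row rmorph_sum; apply: eq_bigr => k _.
  by rewrite Ws rmorphM /= rmorph_int.
have tt : map_mx (@Num.conj _) t = t.
  apply: (can_inj (mulmxK uB)); apply/rowP => i; rewrite tB [RHS]mxE.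
  have := xs (s i); rewrite ss => ->.
  transitivity ((t *m B) 0 (s i))^*; last by rewrite tB mxE.
  rewrite mxE [X in _ = X^*]mxE rmorph_sum; apply: eq_bigr => j _.
  by rewrite mxE rmorphM /= Bs conjCK.
have tr j : t 0 j = ((complex.Re (t 0 j))%:C)%C.
  have /rowP/(_ j) := tt; rewrite mxE; case: (t 0 j) => u v [] /eqP.
  by rewrite eq_sym -subr_eq0 opprK -mulr2n mulrn_eq0 /= => /eqP ->.
pose f j := Num.floor (complex.Re (t 0 j)).
exists (\sum_j f j *: row j V) => i.
have -> : x i = \sum_j ((complex.Re (t 0 j))%:C)%C * emb W (row j V) i.
  have /rowP/(_ i) := tB; rewrite [RHS]mxE => <-; rewrite mxE.
  by apply: eq_bigr => j _; rewrite -tr emb_row.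
have -> : emb W (\sum_j f j *: row j V) i =
    \sum_j (((f j)%:~R : R)%:C)%C * emb W (row j V) i.
  rewrite emb_sum; apply: eq_bigr => j _; rewrite rmorph_int /emb mulr_sumr.
  apply: eq_bigr => k _; rewrite mulrA -intrM.
  by congr (_%:~R * _); rewrite [LHS]mxE.
rewrite -sumrB (le_trans (absC_sum _ _ _)) //.
have -> : d%:R * c = \sum_(j < d) c by rewrite sumr_const card_ord mulr_natl.
apply: ler_sum => j _; rewrite -mulrBl -rmorphB absCM absC_real.
apply: le_trans (Vc i j); rewrite ler_piMl ?absC_ge0 //.
have /andP[f1 f2] := floor_itv (complex.Re (t 0 j)).
by rewrite ger0_norm ?subr_ge0 // lerBlDl -[X in _ + X](rmorph1 intr) -intrD ltW.
Qed.

Variable F : 'M[R[i]]_d.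
Hypothesis dF : \det F != 0.
Hypothesis mulF : forall j k, exists c : 'rV[int]_d, forall i, emb W c i = F i j * F i k.
Hypothesis F_inj : forall u : 'rV[rat]_d, u != 0 ->
  forall i, \sum_j ratr (u 0 j) * F i j != 0.

(* If the short products [f_j f_k] lay in a hyperplane [l = 0], then in every
   permutation term of the nonzero determinant of [l (f_j f_k)] each factor
   would come from a long product, contradicting the bound on [prod n_j]. *)
Lemma short_products_independent (n : 'I_d -> R) (T : R) : (0 < d)%N ->
  (forall i j, absC (F i j) <= n j) -> \prod_j n j ^+ 2 <= T ^+ d -> 0 <= T ->
  exists2 V : 'M[int]_d, \det V != 0 &
    forall i j, absC (emb W (row j V) i) <= T.
Proof.
move=> d0 Fn nT T0.
have n0 j : 0 <= n j by apply: le_trans (Fn j j); apply: absC_ge0.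
have [c0 Hc0] := choice (fun p : 'I_d * 'I_d => mulF p.1 p.2).
pose c j k := c0 (j, k).
have Hc j k i : emb W (c j k) i = F i j * F i k := Hc0 (j, k) i.
pose short (p : 'I_d * 'I_d) := n p.1 * n p.2 <= T.
(* Long pairs contribute a zero row, so that all pairs can index one matrix. *)
pose A0 (p : 'I_#|{: 'I_d * 'I_d}|) : 'rV[int]_d :=
  if short (enum_val p) then c (enum_val p).1 (enum_val p).2 else 0.
have A0T p i : absC (emb W (A0 p) i) <= T.
  rewrite /A0; case: ifP => [sh|_]; last by rewrite emb0 absC0.
  by rewrite Hc absCM (le_trans _ sh) // ler_pM ?absC_ge0.
pose A : 'M[rat]_(_, d) := \matrix_(p, k) (A0 p 0 k)%:~R.
have [fA|nfA] := boolP (row_full A).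
  pose V : 'M[int]_d := \matrix_(j, k) A0 (fullrankfun fA j) 0 k.
  have rV j : row j V = A0 (fullrankfun fA j) by apply/rowP => k; rewrite !mxE.
  exists V; last by move=> i j; rewrite rV.
  have := mxrank_fullrowsub fA.
  have -> : rowsub (fullrankfun fA) A = map_mx intr V.
    by apply/matrixP => j k; rewrite !mxE.
  move=> rk; have : row_full (map_mx (intr : int -> rat) V) by apply/eqP.
  by rewrite row_full_unit unitmxE det_map_mx unitfE intr_eq0.
have [y yA y0] : exists2 y : 'rV_d, y *m A^T = 0 & y != 0.
  have : ~~ row_free A^T by rewrite /row_free mxrank_tr.
  by rewrite -kermx_eq0 => /rowV0Pn [y /sub_kermxP yA y0]; exists y.
pose l := y^T.
have Al : A *m l = 0 by rewrite -[A]trmxK -trmx_mul yA trmx0.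
pose cq j k : 'rV[rat]_d := map_mx intr (c j k).
pose G : 'M[rat]_d := \matrix_(j, k) (cq j k *m l) 0 0.
(* For [u] in the kernel, all products of [f = sum u_j f_j] with the [f_k] would lie in the
   hyperplane, so [M] would be singular. But up to nonzero factors its determinant is the product of
   the embeddings of [f]. *)
have dG : \det G != 0.
  apply/negP => /det0P [u u0 uG].
  pose M : 'M[rat]_d := \matrix_(k, m) \sum_j u 0 j * cq j k 0 m.
  have Ml : M *m l = 0.
    apply/colP => k; have /rowP/(_ k) := uG; rewrite !mxE => E.
    rewrite -[RHS]E.
    under eq_bigr do rewrite mxE mulr_suml.
    rewrite exchange_big; apply: eq_bigr => j _; rewrite !mxE mulr_sumr.
    by apply: eq_bigr => m _; rewrite mulrA.
  have dM : \det M = 0.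
    apply/eqP; rewrite -det_tr; apply/det0P; exists y => //.
    by rewrite -[y]trmxK -trmx_mul Ml trmx0.
  have E : map_mx (ratr : rat -> R[i]) M *m W^T =
      F^T *m diag_mx (\row_i \sum_j ratr (u 0 j) * F i j).
    apply/matrixP => k i; rewrite mul_mx_diag !mxE mulr_sumr.
    under eq_bigr do rewrite mxE mxE rmorph_sum mulr_suml.
    rewrite exchange_big; apply: eq_bigr => j _.
    rewrite mulrCA [F i k * _]mulrC -Hc /emb mulr_sumr; apply: eq_bigr => m _.
    by rewrite mxE rmorphM /= mxE ratr_int mulrA.
  have := congr1 determinant E; rewrite det_mulmx det_map_mx dM rmorph0 mul0r.
  move/esym/eqP; rewrite det_mulmx det_tr det_diag mulf_eq0 (negPf dF) /=.
  by apply/negP/prodf_neq0 => i _; rewrite mxE F_inj.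
have [s Hs] : exists s : 'S_d, forall j, G j (s j) != 0.
  apply: contrapT => nos; case/negP: dG; apply/eqP; rewrite /determinant big1 // => s _.
  have [j Gj] : exists j, G j (s j) == 0.
    apply: contrapT => nj; apply: nos; exists s => j; apply/negP => Gj.
    by apply: nj; exists j.
  by rewrite (bigD1 j) //= (eqP Gj) mul0r mulr0.
have long j : T < n j * n (s j).
  rewrite ltNge; apply: contra (Hs j) => sh.
  have /colP/(_ (enum_rank (j, s j))) := Al; rewrite [RHS]mxE => E.
  rewrite mxE -[X in _ == X]E; apply/eqP.
  rewrite [LHS]mxE [RHS]mxE; apply: eq_bigr => k _; congr (_ * _).
  by rewrite !mxE /A0 enum_rankK /short /= sh.
have : T ^+ d < \prod_j n j ^+ 2.
  have -> : \prod_j n j ^+ 2 = \prod_j (n j * n (s j)).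
    under eq_bigr do rewrite expr2.
    by rewrite !big_split /= [X in _ = _ * X](reindex_inj (@perm_inj _ s^-1%g)) /=; congr (_ * _);
      apply: eq_bigr => j _; rewrite permKV.
  have -> : T ^+ d = \prod_(j < d) T by rewrite prodr_const card_ord.
  apply: ltr_prod; first by apply/hasP; exists (Ordinal d0); rewrite ?mem_index_enum.
  by move=> j _; rewrite T0 long.
by rewrite ltNge nT.
Qed.

End Transference.

(** * Conjugates and algebraic integers *)

Section AlgebraicIntegers.
Variable R : realType.
Local Notation C := (R[i]).

Lemma algintP (z : C) : algint z <-> integralOver (intr : int -> C) z.
Proof. by split=> [[p [mp rp]]|[p mp rp]]; exists p. Qed.

Lemma algintD (x y : C) : algint x -> algint y -> algint (x + y).
Proof. by rewrite !algintP; apply: integral_add. Qed.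

Lemma algintB (x y : C) : algint x -> algint y -> algint (x - y).
Proof. by rewrite !algintP; apply: integral_sub. Qed.

Lemma algintM (x y : C) : algint x -> algint y -> algint (x * y).
Proof. by rewrite !algintP; apply: integral_mul. Qed.

Lemma algint_int (m : int) : algint (m%:~R : C).
Proof. by rewrite algintP; apply: integral_id. Qed.

Lemma algint_sum (I : Type) (r : seq I) (P : pred I) (F : I -> C) :
  (forall i, P i -> algint (F i)) -> algint (\sum_(i <- r | P i) F i).
Proof.
move=> FP; elim/big_rec: _ => [|i x Pi]; first exact: (algint_int 0).
by apply: algintD; apply: FP.
Qed.

(** The claim is transported to [algC], where rational algebraic integers are known to be
    integers. *)
Lemma algint_rat (x : rat) : algint (ratr x : C) -> exists m : int, x = m%:~R.
Proof.
move=> [p [mp rp]].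
have rx : root (map_poly intr p) x.
  rewrite -(fmorph_root (ratr : rat -> C)) -map_poly_comp.
  by rewrite (eq_map_poly (g := intr)) // => m; rewrite /= ratr_int.
have : (ratr x : algC) \in Aint.
  apply: (root_monic_Aint (p := map_poly intr p)).
  - rewrite (eq_map_poly (g := (ratr : rat -> algC) \o intr)).
      by rewrite map_poly_comp fmorph_root.
    by move=> m; rewrite /= ratr_int.
  - exact: monic_map.
  by apply/polyOverP => i; rewrite coef_map /= intr_int.
move/(Cint_rat_Aint (Crat_rat x)) => /intrP [m xm].
by exists m; apply: (fmorph_inj (ratr : rat -> algC)); rewrite rmorph_int.
Qed.

Lemma evM (p q : {poly rat}) (z : C) : ev (p * q) z = ev p z * ev q z.
Proof. by rewrite /ev rmorphM hornerM. Qed.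

Lemma evD (p q : {poly rat}) (z : C) : ev (p + q) z = ev p z + ev q z.
Proof. by rewrite /ev rmorphD hornerD. Qed.

Lemma evN (p : {poly rat}) (z : C) : ev (- p) z = - ev p z.
Proof. by rewrite /ev rmorphN hornerN. Qed.

Lemma evB (p q : {poly rat}) (z : C) : ev (p - q) z = ev p z - ev q z.
Proof. by rewrite evD evN. Qed.

Lemma evZ c (p : {poly rat}) (z : C) : ev (c *: p) z = ratr c * ev p z.
Proof. by rewrite /ev map_polyZ hornerZ. Qed.

Lemma evX (z : C) : ev 'X z = z.
Proof. by rewrite /ev map_polyX hornerX. Qed.

Lemma evXn n (z : C) : ev 'X^n z = z ^+ n.
Proof. by rewrite /ev map_polyXn hornerXn. Qed.

Lemma ev_sum (I : Type) (r : seq I) (P : pred I) (F : I -> {poly rat}) (z : C) :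
  ev (\sum_(i <- r | P i) F i) z = \sum_(i <- r | P i) ev (F i) z.
Proof.
elim/big_rec2: _ => [|i x y _ <-]; last by rewrite evD.
by rewrite /ev rmorph0 horner0.
Qed.

Lemma ev_coef n (p : {poly rat}) (z : C) : (size p <= n)%N ->
  ev p z = \sum_(k < n) ratr p`_k * z ^+ k.
Proof.
move=> pn; rewrite /ev (horner_coef_wide _ (n := n)) ?size_map_poly //.
by apply: eq_bigr => k _; rewrite coef_map.
Qed.

Lemma ev_conj (p : {poly rat}) (z : C) : ev p (z^*) = (ev p z)^*.
Proof.
rewrite /ev -horner_map -map_poly_comp; congr (_.[_]); apply: eq_map_poly => x /=.
by rewrite fmorph_rat.
Qed.
End AlgebraicIntegers.

(** * Conjugates, embeddings and traces *)

Section Conjugates.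
Local Open Scope classical_set_scope.
Variables (R : realType) (lam : R[i]) (P : {poly rat}).
Hypothesis mP : minpolyQ lam P.

(** An irreducible polynomial is coprime to what it does not divide, and coprime polynomials have no
    common root. *)
Lemma minpolyQ_dvd (q : {poly rat}) (z : R[i]) :
  ev P z = 0 -> ev q z = 0 -> P %| q.
Proof.
move=> Pz qz; have [_ [irrP _]] := mP.
apply: contraT; rewrite -(irreducible_poly_coprime _ irrP).
rewrite -(coprimep_map (ratr : rat -> R[i])).
by move=> /coprimep_root/(_ (introT eqP Pz : root _ z)) /eqP.
Qed.

Lemma minpolyQ_root (q : {poly rat}) (z z' : R[i]) :
  ev P z = 0 -> ev P z' = 0 -> ev q z = 0 -> ev q z' = 0.
Proof.
move=> Pz Pz' /(minpolyQ_dvd Pz) /dvdpP [r ->].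
by rewrite evM Pz' mulr0.
Qed.

Lemma minpolyQ_neq0 : P != 0.
Proof. by have [/monic_neq0] := mP. Qed.

Lemma minpolyQ_separable : separable_poly P.
Proof.
have [monP [irrP _]] := mP; have sP : (1 < size P)%N := irrP.1.
rewrite unlock irreducible_poly_coprime // gtNdvdp //; last first.
  by rewrite lt_size_deriv ?minpolyQ_neq0.
apply/eqP => /(congr1 (fun q : {poly rat} => q`_(size P).-2)) /eqP.
rewrite coef_deriv coef0 mulrn_eq0 /=.
have -> : (size P).-2.+1 = (size P).-1 by rewrite prednK // -subn1 subn_gt0.
by rewrite -lead_coefE (monicP monP) oner_eq0.
Qed.

Lemma conjs_spec : uniq (conjs R P) /\
  forall z, z \in conjs R P <-> root (map_poly ratr P) z.
Proof.
rewrite /conjs; apply: (@xgetPex _ _ [set s : seq R[i] | uniq s /\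
  forall z, z \in s <-> root (map_poly ratr P) z]).
have [r Dr] := closed_field_poly_normal (map_poly (ratr : rat -> R[i]) P).
have lc0 : lead_coef (map_poly (ratr : rat -> R[i]) P) != 0.
  by rewrite lead_coef_eq0 map_poly_eq0 minpolyQ_neq0.
exists r; split.
  rewrite -separable_prod_XsubC -(eqp_separable (eqp_scale _ lc0)) -Dr.
  by rewrite separable_map minpolyQ_separable.
by move=> z; rewrite Dr rootZ // root_prod_XsubC.
Qed.

Lemma size_conjs : size (conjs R P) = deg P.
Proof.
have [us sP] := conjs_spec.
have [r Dr] := closed_field_poly_normal (map_poly (ratr : rat -> R[i]) P).
have lc0 : lead_coef (map_poly (ratr : rat -> R[i]) P) != 0.
  by rewrite lead_coef_eq0 map_poly_eq0 minpolyQ_neq0.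
have ur : uniq r.
  rewrite -separable_prod_XsubC -(eqp_separable (eqp_scale _ lc0)) -Dr.
  by rewrite separable_map minpolyQ_separable.
have -> : size (conjs R P) = size r.
  apply: perm_size; apply: uniq_perm => // z; apply/idP/idP.
    by move=> /sP; rewrite Dr rootZ // root_prod_XsubC.
  by move=> zr; apply/sP; rewrite Dr rootZ // root_prod_XsubC.
by rewrite /deg -(size_map_poly (ratr : rat -> R[i])) Dr size_scale // size_prod_XsubC.
Qed.

(** The indices stand for the embeddings: the [i]-th one sends [q(lam)] to [q(cj i)]. *)
Definition cj (i : 'I_(deg P)) : R[i] := nth 0 (conjs R P) i.

Lemma cj_mem i : cj i \in conjs R P.
Proof. by rewrite mem_nth // size_conjs. Qed.

Lemma cjP i : ev P (cj i) = 0.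
Proof. by have /(proj2 conjs_spec)/eqP := cj_mem i. Qed.

Lemma cj_inj : injective cj.
Proof.
move=> i j /eqP; rewrite nth_uniq ?size_conjs //; last exact: conjs_spec.1.
by move=> /eqP/val_inj.
Qed.

Lemma cj_surj z : ev P z = 0 -> exists i, cj i = z.
Proof.
move=> Pz; have zc : z \in conjs R P by apply/conjs_spec.2; apply/eqP.
have h : (index z (conjs R P) < deg P)%N by rewrite -size_conjs index_mem.
by exists (Ordinal h); rewrite /cj nth_index.
Qed.

Lemma big_conjs (K : Type) (idx : K) (op : Monoid.com_law idx) (F : R[i] -> K) :
  \big[op/idx]_(z <- conjs R P) F z = \big[op/idx]_i F (cj i).
Proof. by rewrite (big_nth 0) size_conjs big_mkord. Qed.

Lemma lam_root : ev P lam = 0.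
Proof. by have [_ [_ /eqP]] := mP. Qed.

Lemma ev_lam_cj q i : ev q lam = 0 <-> ev q (cj i) = 0.
Proof.
by split; apply: minpolyQ_root; rewrite ?cjP ?lam_root.
Qed.

Lemma cj_conj : exists s : 'I_(deg P) -> 'I_(deg P),
  involutive s /\ forall i, cj (s i) = (cj i)^*.
Proof.
have [i|s Hs] := choice (fun i => cj_surj (z := (cj i)^*) _).
  by rewrite ev_conj cjP conjC0.
by exists s; split=> // i; apply: cj_inj; rewrite !Hs conjCK.
Qed.

Lemma inOK_cj q i : inOK lam q -> algint (ev q (cj i)).
Proof.
move=> [p [mp /eqP rp]]; exists p; split=> //.
have E z : (map_poly intr p).[ev q z] = ev (map_poly intr p \Po q) z.
  rewrite /ev map_comp_poly horner_comp -map_poly_comp; congr (_.[_]).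
  by apply: eq_map_poly => m /=; rewrite ratr_int.
by apply/eqP; rewrite E; apply/ev_lam_cj; rewrite -E.
Qed.

(** Multiplication by [q] on [Q[X]/(P)] in the power basis, acting on rows. *)
Definition mul_rat_mx (q : {poly rat}) : 'M[rat]_(deg P) :=
  \matrix_(k, l) (('X^k * q) %% P)`_l.

Lemma deg_modp (q : {poly rat}) : (size (q %% P)%R <= deg P)%N.
Proof.
by have := ltn_modp q P; rewrite minpolyQ_neq0 /deg; case: (size P).
Qed.

Lemma ev_modp q i : ev (q %% P) (cj i) = ev q (cj i).
Proof. by rewrite [in RHS](divp_eq q P) evD evM cjP mulr0 add0r. Qed.

Definition vdm : 'M[R[i]]_(deg P) := \matrix_(i, k) cj i ^+ k.

Lemma det_vdm : \det vdm != 0.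
Proof.
rewrite -det_tr; have -> : vdm^T = Vandermonde (deg P) (\row_i cj i).
  by apply/matrixP => i j; rewrite !mxE.
rewrite det_Vandermonde; apply/prodf_neq0 => i _; apply/prodf_neq0 => j ij.
rewrite !mxE subr_eq0; apply: contraTneq ij => /cj_inj ->.
by rewrite ltnn.
Qed.

(** The Vandermonde matrix diagonalises multiplication by [q], with the conjugates as
    eigenvalues. *)
Lemma trace_rational q : \sum_i ev q (cj i) = ratr (\tr (mul_rat_mx q)).
Proof.
have E : vdm *m map_mx ratr (mul_rat_mx q)^T = diag_mx (\row_i ev q (cj i)) *m vdm.
  apply/matrixP => i k; rewrite mul_diag_mx !mxE mulrC -evXn -evM -ev_modp.
  rewrite (ev_coef _ (deg_modp _)); apply: eq_bigr => l _.
  by rewrite !mxE mulrC.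
have uV : vdm \in unitmx by rewrite unitmxE unitfE det_vdm.
rewrite -mxtrace_tr -(trace_map_mx (ratr : rat -> R[i])).
rewrite -[map_mx _ _](mulKmx uV) E mxtrace_mulC -mulmxA mulmxV // mulmx1.
by rewrite /mxtrace; apply: eq_bigr => i _; rewrite !mxE eqxx mulr1n.
Qed.

Lemma trace_int q : inOK lam q -> exists m : int, \sum_i ev q (cj i) = m%:~R.
Proof.
move=> Oq; have [m Dm] : exists m : int, \tr (mul_rat_mx q) = m%:~R.
  apply: (@algint_rat R); rewrite -trace_rational.
  by apply: algint_sum => i _; apply: inOK_cj.
by exists m; rewrite trace_rational Dm ratr_int.
Qed.
End Conjugates.

(** * Integral bases *)

Section IntegralBasis.
Variables (R : realType) (lam : R[i]) (P : {poly rat}).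
Hypotheses (mP : minpolyQ lam P) (lam_int : algint lam).
Local Notation d := (deg P).
Local Notation cj := (@cj R P).

Definition emat (w : 'I_d -> {poly rat}) : 'M[R[i]]_d := \matrix_(i, j) ev (w j) (cj i).

Lemma inOKB p q : inOK lam p -> inOK lam q -> inOK lam (p - q).
Proof. by rewrite /inOK evB; apply: algintB. Qed.

Lemma inOKM p q : inOK lam p -> inOK lam q -> inOK lam (p * q).
Proof. by rewrite /inOK evM; apply: algintM. Qed.

Lemma ev_int (m : int) (z : R[i]) : ev (m%:~R)%:P z = m%:~R.
Proof. by rewrite /ev map_polyC hornerC /= ratr_int. Qed.

Lemma inOK_int (m : int) : inOK lam (m%:~R)%:P.
Proof.
by rewrite /inOK ev_int; apply: algint_int.
Qed.

Lemma inOKX : inOK lam 'X. Proof. by rewrite /inOK evX. Qed.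

Lemma inOKXn n : inOK lam 'X^n.
Proof.
elim: n => [|n IH]; first by have := inOK_int 1.
by rewrite exprS; apply: inOKM; [exact: inOKX|].
Qed.

Definition lincomb (w : 'I_d -> {poly rat}) (u : 'rV[rat]_d) : {poly rat} :=
  \sum_j u 0 j *: w j.

Lemma ev_lincomb w u z : ev (lincomb w u) z = \sum_j ratr (u 0 j) * ev (w j) z :> R[i].
Proof. by rewrite ev_sum; apply: eq_bigr => j _; rewrite evZ. Qed.

Lemma ev_int_lincomb w (u : 'rV[int]_d) z :
  ev (lincomb w (map_mx intr u)) z = \sum_j (u 0 j)%:~R * ev (w j) z :> R[i].
Proof. by rewrite ev_lincomb; apply: eq_bigr => j _; rewrite mxE ratr_int. Qed.

Lemma inOK_lincomb w (u : 'rV[int]_d) :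
  (forall j, inOK lam (w j)) -> inOK lam (lincomb w (map_mx intr u)).
Proof.
move=> wO; rewrite /inOK ev_int_lincomb; apply: algint_sum => j _.
by apply: algintM; [exact: algint_int|exact: wO].
Qed.

Lemma emb_emat w (u : 'rV[int]_d) i :
  emb (emat w) u i = ev (lincomb w (map_mx intr u)) (cj i).
Proof. by rewrite ev_int_lincomb; apply: eq_bigr => j _; rewrite mxE. Qed.

(** The square is the determinant of the trace form, whose entries are rational algebraic
    integers. *)
Lemma disc_int w : (forall j, inOK lam (w j)) ->
  exists m : int, \det (emat w) ^+ 2 = m%:~R.
Proof.
move=> wO.
have [f Hf] := choice (fun p : 'I_d * 'I_d =>
  trace_int mP (inOKM (wO p.1) (wO p.2))).
exists (\det (\matrix_(j, k) f (j, k))).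
rewrite expr2 -{1}det_tr -det_mulmx -det_map_mx; congr (\det _).
apply/matrixP => j k; rewrite !mxE -[RHS]/((f (j, k))%:~R) -Hf; apply: eq_bigr => i _.
by rewrite !mxE evM.
Qed.

Lemma emat_Xn : emat (fun j => 'X^j) = vdm R P.
Proof. by apply/matrixP => i j; rewrite !mxE evXn. Qed.

Definition coef_mx (w : 'I_d -> {poly rat}) : 'M[rat]_d :=
  \matrix_(j, k) (w j %% P)`_k.

Lemma emat_coef w : emat w = vdm R P *m map_mx ratr (coef_mx w)^T.
Proof.
apply/matrixP => i j; rewrite !mxE -(ev_modp mP) (ev_coef _ (deg_modp mP _)).
by apply: eq_bigr => k _; rewrite !mxE mulrC.
Qed.

Lemma coef_mx_unit w : \det (emat w) != 0 -> coef_mx w \in unitmx.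
Proof.
rewrite emat_coef det_mulmx mulf_eq0 negb_or det_map_mx det_tr fmorph_eq0.
by rewrite unitmxE unitfE => /andP[].
Qed.

Lemma rat_coordinates w q : \det (emat w) != 0 ->
  exists t : 'rV[rat]_d, forall i, ev q (cj i) = ev (lincomb w t) (cj i).
Proof.
move=> dw; have uw := coef_mx_unit dw.
pose cq : 'rV[rat]_d := \row_k (q %% P)`_k.
exists (cq *m invmx (coef_mx w)) => i; set t := cq *m _.
have tw : t *m coef_mx w = cq by rewrite mulmxKV.
rewrite -(ev_modp mP) (ev_coef _ (deg_modp mP _)) ev_lincomb.
under [RHS]eq_bigr => j _.
  rewrite -(ev_modp mP) (ev_coef _ (deg_modp mP _)) mulr_sumr.
  over.
rewrite exchange_big; apply: eq_bigr => k _.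
have /rowP/(_ k) := tw; rewrite [RHS]mxE => <-.
rewrite mxE rmorph_sum mulr_suml; apply: eq_bigr => j _.
by rewrite rmorphM /= mulrA; congr (_ * _ * _); rewrite mxE.
Qed.

(* A family in [O_K] with minimal nonzero discriminant is a Z-basis: replacing
   one member by [q - floor(t_j) w_j] multiplies the discriminant by the square
   of the fractional part of the coordinate [t_j]. *)
Lemma Zbasis_exists : exists w, Zbasis lam w /\ \det (emat w) != 0.
Proof.
pose Q n := `[< exists w, (forall j, inOK lam (w j)) /\ \det (emat w) != 0 /\
  exists m : int, \det (emat w) ^+ 2 = m%:~R /\ `|m|%N = n >].
have exQ : exists n, Q n.
  have [m Dm] := disc_int (w := fun j => 'X^j) (fun j => inOKXn j).
  exists `|m|%N; apply/asboolP; exists (fun j => 'X^j); split.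
    by move=> j; exact: inOKXn.
  by rewrite emat_Xn (det_vdm mP); split=> //; exists m; rewrite -emat_Xn.
case: (ex_minnP exQ) => n /asboolP [w [wO [dw [m [Dm mn]]]]] nmin.
exists w; split=> //; split=> //; split; last first.
  move=> c c0.
  pose u : 'rV[int]_d := \row_j c j.
  have E : forall i, ev (lincomb w (map_mx intr u)) (cj i) = 0.
    move=> i; apply/(ev_lam_cj mP); rewrite ev_int_lincomb -[RHS]c0.
    by apply: eq_bigr => j _; rewrite mxE.
  have uW : map_mx intr u *m (emat w)^T = 0.
    by apply/rowP => i; rewrite -embE emb_emat E mxE.
  have : map_mx (intr : int -> R[i]) u = 0.
    have uWu : (emat w)^T \in unitmx by rewrite unitmx_tr unitmxE unitfE.
    by rewrite -[LHS](mulmxK uWu) uW mul0mx.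
  move=> /rowP H j; have /eqP := H j; rewrite !mxE intr_eq0 => /eqP //.
move=> q qO; have [t Ht] := rat_coordinates q dw.
have tint j : t 0 j = (Num.floor (t 0 j))%:~R.
  apply/eqP/negPn/negP => tj.
  pose f := t 0 j - (Num.floor (t 0 j))%:~R.
  have /andP[f1 f2] := floor_itv (t 0 j).
  have f0 : 0 < f by rewrite subr_gt0 lt_def tj.
  have f1' : f < 1 by rewrite /f ltrBlDl; move: f2; rewrite intrD.
  pose w' k := if k == j then q - (Num.floor (t 0 j))%:~R%:P * w j else w k.
  have w'O k : inOK lam (w' k).
    rewrite /w'; case: eqP => _; last exact: wO.
    exact: (inOKB qO (inOKM (inOK_int _) (wO j))).
  have dw' : \det (emat w') = ratr f * \det (emat w).
    rewrite -det_tr -[in RHS]det_tr.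
    pose z := \row_k (ratr (t 0 k - (Num.floor (t 0 j))%:~R * (k == j)%:R) : R[i]).
    have -> : (emat w')^T = repl_row (emat w)^T j (z *m (emat w)^T).
      apply/matrixP => k i; rewrite !mxE /w'; case: eqP => [_|//].
      rewrite evB evM Ht ev_int ev_lincomb.
      under [RHS]eq_bigr do rewrite !mxE rmorphB rmorphM /= ratr_int ratr_nat mulrBl.
      rewrite sumrB; congr (_ - _).
      rewrite (bigD1 j) //= eqxx mulr1 big1 ?addr0 // => k' kj.
      by rewrite (negPf kj) mulr0 mul0r.
    rewrite det_repl_row -mulmxA mul_mx_adj mul_mx_scalar mxE mulrC; congr (_ * _).
    by rewrite mxE eqxx mulr1.
  have [m' Dm'] := disc_int w'O.
  have Em : (m'%:~R : rat) = f ^+ 2 * m%:~R.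
    apply: (fmorph_inj (ratr : rat -> R[i])).
    by rewrite rmorphM rmorphXn /= !ratr_int -Dm -Dm' dw' exprMn.
  have m0 : m != 0.
    by rewrite -(intr_eq0 R[i]) -Dm expf_neq0.
  have : (n <= `|m'|)%N.
    apply: nmin; apply/asboolP; exists w'; split=> //; split; last by exists m'.
    by rewrite dw' mulf_neq0 // fmorph_eq0 gt_eqF.
  rewrite -mn -lez_nat !abszE -(ler_int rat) !intr_norm Em normrM.
  have am : 0 < `|m%:~R : rat| by rewrite normr_gt0 intr_eq0.
  rewrite ler_pMl // ger0_norm ?sqr_ge0 // => h.
  by have : f ^+ 2 < 1; [rewrite expr_lt1 // ltW | rewrite ltNge h].
exists (fun j => Num.floor (t 0 j)); apply/eqP; rewrite -subr_eq0; apply/eqP.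
have -> : \sum_j (Num.floor (t 0 j))%:~R * ev (w j) lam = ev (lincomb w t) lam.
  by rewrite ev_lincomb; apply: eq_bigr => j _; rewrite [in RHS]tint ratr_int.
have [i0 i0l] := cj_surj mP (lam_root mP).
by rewrite -i0l Ht subrr.
Qed.

Lemma OK_coordinates w q : Zbasis lam w -> inOK lam q ->
  exists z, forall i, emb (emat w) z i = ev q (cj i).
Proof.
move=> [_ [w2 _]] /w2 [c Hc]; exists (\row_j c j) => i.
rewrite emb_emat; apply/eqP; rewrite -subr_eq0 -evB; apply/eqP/(ev_lam_cj mP).
rewrite evB ev_int_lincomb Hc; apply/eqP; rewrite subr_eq0; apply/eqP.
by apply: eq_bigr => j _; rewrite mxE.
Qed.

(** Some basis [w0] has nonzero determinant, which is a multiple of that of [w] because [w0] has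
    integer coordinates in [w]. *)
Lemma Zbasis_det w : Zbasis lam w -> \det (emat w) != 0.
Proof.
move=> wB; have [w0 [[w0O _] dw0]] := Zbasis_exists.
have [z Hz] := choice (fun j => OK_coordinates wB (w0O j)).
apply: contraNneq dw0 => dw.
have -> : emat w0 = emat w *m (map_mx intr (\matrix_(j, k) z j 0 k))^T.
  apply/matrixP => i j; rewrite !mxE -Hz /emb; apply: eq_bigr => k _.
  by rewrite !mxE mulrC.
by rewrite det_mulmx dw mul0r.
Qed.

Lemma emat_inj w : \det (emat w) != 0 -> forall u : 'rV[rat]_d, u != 0 ->
  forall i, \sum_j ratr (u 0 j) * emat w i j != 0.
Proof.
move=> dw u u0 i; apply: contraNneq u0 => ui.
have E i' : ev (lincomb w u) (cj i') = 0.
  apply: (minpolyQ_root mP (cjP mP i) (cjP mP i')).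
  by rewrite ev_lincomb -[RHS]ui; apply: eq_bigr => j _; rewrite mxE.
have uW : map_mx ratr u *m (emat w)^T = 0.
  apply/rowP => i'; rewrite [RHS]mxE -[RHS](E i') ev_lincomb mxE.
  by apply: eq_bigr => j _; rewrite !mxE.
have uWu : (emat w)^T \in unitmx by rewrite unitmx_tr unitmxE unitfE.
have : map_mx (ratr : rat -> R[i]) u = 0 by rewrite -[LHS](mulmxK uWu) uW mul0mx.
by move=> /eqP; rewrite map_mx_eq0.
Qed.

Lemma emat_conj w s : (forall i, cj (s i) = (cj i)^*) ->
  forall i j, emat w (s i) j = (emat w i j)^*.
Proof. by move=> sP i j; rewrite !mxE sP ev_conj. Qed.
End IntegralBasis.

(** * Gram matrices *)

Section GramMatrix.
Variables (R : realType) (lam : R[i]) (P : {poly rat}).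
Hypotheses (mP : minpolyQ lam P).
Local Notation d := (deg P).
Local Notation cj := (@cj R P).

Lemma conj_real (t : R) : ((t%:C)%C)^* = (t%:C)%C.
Proof. by apply/CrealP; rewrite complex_real. Qed.

Definition gram_mx (alpha : R[i] -> R) (w : 'I_d -> {poly rat}) : 'M[R]_d :=
  \matrix_(j, k) bform P alpha (ev (w j)) (ev (w k)).

(** [bform] takes real parts termwise; conjugate embeddings carry equal weights, so the full
    Hermitian sum is already real. *)
Lemma gram_mxE alpha w : admissible P alpha ->
  map_mx (real_complex R) (gram_mx alpha w) =
  (emat R w)^T *m diag_mx (\row_i ((alpha (cj i))%:C)%C) *m map_mx Num.conj (emat R w).
Proof.
move=> adm; have [s [ss sP]] := cj_conj mP.
have as_ i : alpha (cj (s i)) = alpha (cj i).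
  by rewrite sP; apply: (adm _ (cj_mem mP i)).2.
apply/matrixP => j k; rewrite [LHS]mxE [RHS]mxE [gram_mx _ _ _ _]mxE /bform (big_conjs mP) /=.
set t := RHS.
have Dt : t = \sum_i ((alpha (cj i))%:C)%C * (ev (w j) (cj i) * (ev (w k) (cj i))^*).
  by apply: eq_bigr => i _; rewrite mul_mx_diag !mxE mulrAC mulrC.
have tt : t^* = t.
  rewrite Dt rmorph_sum (reindex_inj (inv_inj ss)); apply: eq_bigr => i _.
  rewrite !rmorphM /= sP !ev_conj !conjCK -sP as_.
  by rewrite conj_real.
have -> : t = ((complex.Re t)%:C)%C.
  by rewrite RRe_real //; apply/CrealP.
congr (_%:C)%C; rewrite Dt Re_sum; apply: eq_bigr => i _.
by rewrite Re_realM.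
Qed.

Lemma det_gram_mx alpha w : admissible P alpha ->
  \det (gram_mx alpha w) = \prod_i alpha (cj i) * absC (\det (emat R w)) ^+ 2.
Proof.
move=> adm; apply: complexI; rewrite -[LHS]det_map_mx (gram_mxE w adm).
rewrite !det_mulmx det_tr det_diag det_map_mx rmorphM /= sqr_absC mulrAC mulrC.
rewrite rmorph_prod; congr (_ * _).
by apply: eq_bigr => i _; rewrite mxE.
Qed.

Lemma admissible1 : admissible P (fun=> 1 : R).
Proof. by []. Qed.

Lemma quad_gram w (x : 'rV[R]_d) :
  quad (gram_mx (fun=> 1) w) x =
  \sum_i absC (\sum_j ((x 0 j)%:C)%C * emat R w i j) ^+ 2.
Proof.
apply: complexI; rewrite rmorph_sum /quad.
transitivity ((map_mx (real_complex R) (x *m gram_mx (fun=> 1) w *m x^T)) 0 0).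
  by rewrite [RHS]mxE.
rewrite !map_mxM gram_mxE; last exact: admissible1.
have -> : diag_mx (\row_i ((1 : R)%:C)%C) = 1%:M :> 'M[R[i]]_d.
  by apply/matrixP => i j; rewrite !mxE.
rewrite mulmx1 mulmxA -mulmxA mxE; apply: eq_bigr => i _.
apply: (etrans _ (esym (sqr_absC _))); congr (_ * _).
  by rewrite mxE; apply: eq_bigr => j _; rewrite !mxE.
rewrite mxE rmorph_sum; by apply: eq_bigr => j _; rewrite [RHS]rmorphM /= conj_real !mxE mulrC.
Qed.

Lemma posdef_gram w : \det (emat R w) != 0 -> posdef (gram_mx (fun=> 1) w).
Proof.
move=> dw; split.
  apply/matrixP => j k; rewrite !mxE; apply: eq_bigr => z _; congr (_ * _).
  by rewrite -[LHS]Re_conjE rmorphM /= conjCK mulrC.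
move=> x x0; rewrite quad_gram.
have [i xi] : exists i, \sum_j ((x 0 j)%:C)%C * emat R w i j != 0.
  apply: contrapT => H.
  have uWu : (emat R w)^T \in unitmx by rewrite unitmx_tr unitmxE unitfE.
  have xW : map_mx (real_complex R) x *m (emat R w)^T = 0.
    apply/rowP => i; rewrite [RHS]mxE; apply/eqP/negPn/negP => xi; apply: H; exists i.
    apply: contraNneq xi => <-; rewrite mxE; apply/eqP/eq_bigr => j _.
    by rewrite !mxE.
  case/negP: x0; rewrite -(map_mx_eq0 (real_complex R)).
  by rewrite -[X in X == 0](mulmxK uWu) xW mul0mx.
rewrite (bigD1 i) //= ltr_pwDl //.
  by rewrite exprn_gt0 // lt_def absC_eq0 xi absC_ge0.
by apply: sumr_ge0 => j _; rewrite exprn_ge0 ?absC_ge0.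
Qed.

(** Points of [K_R] are families over the embeddings; the condition on [i] and [j] expresses
    compatibility with conjugation without naming the permutation. *)
Definition cov_by (w : 'I_d -> {poly rat}) (a : 'I_d -> R) (r : R) :=
  forall x : 'I_d -> R[i], (forall i j, cj j = (cj i)^* -> x j = (x i)^*) ->
    exists z, forall i, a i * absC (x i - emb (emat R w) z i) <= r.

Lemma cov_by_independent w (V : 'M[int]_d) c : \det (emat R w) != 0 ->
  \det V != 0 -> (forall i j, absC (emb (emat R w) (row j V) i) <= c) ->
  cov_by w (fun=> 1) (d%:R * c).
Proof.
move=> dw dV Vc x xs; have [s [ss sP]] := cj_conj mP.
have [|z Hz] := cov_of_independent dw ss (emat_conj w sP) dV Vc (x := x).
  by move=> i; apply: xs.
by exists z => i; rewrite mul1r.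
Qed.

(* Hermite reduction yields a basis of [O_K] whose product of squared lengths is
   comparable to the discriminant, as [short_products_independent] requires. *)
Lemma cov_by_disc w : algint lam -> Zbasis lam w -> (0 < d)%N ->
  exists T, [/\ 0 < T, T ^+ d = (4 / 3) ^+ 'C(d, 2) * absC (\det (emat R w)) ^+ 2 &
    cov_by w (fun=> 1) (d%:R * T)].
Proof.
move=> lamI wB d0; have dw := Zbasis_det mP lamI wB; have [wO _] := wB.
have [U uU HU] := hermite_reduction (posdef_gram dw).
pose f j := lincomb w (map_mx intr (row j U)).
have fE : emat R f = emat R w *m (map_mx intr U)^T.
  apply/matrixP => i j; rewrite mxE ev_int_lincomb mxE; apply: eq_bigr => k _.
  by rewrite !mxE mulrC.
have dU : \det U != 0.
  by move: uU; rewrite unitmxE; apply: contraTneq => ->; rewrite unitr0.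
have df : \det (emat R f) != 0.
  by rewrite fE det_mulmx mulf_neq0 // det_tr det_map_mx intr_eq0.
pose C : R := (4 / 3) ^+ 'C(d, 2) * absC (\det (emat R w)) ^+ 2.
have C0 : 0 < C.
  by rewrite mulr_gt0 ?exprn_gt0 ?divr_gt0 // lt_def absC_eq0 dw absC_ge0.
(* The [d]-th root, so that [T ^+ d] equals the bound of Hermite reduction on the product of squared
   lengths. *)
pose T := powR C (d%:R^-1).
have T0 : 0 < T by rewrite powR_gt0.
have Td : T ^+ d = C.
  by rewrite -powR_mulrn ?(ltW T0) // -powRrM mulVf ?powRr1 ?(ltW C0) // pnatr_eq0 -lt0n.
pose n j := Num.sqrt (quad (gram_mx (fun=> 1) w) (row j (map_mx intr U))).
have pG := posdef_gram dw.
have Qf j : quad (gram_mx (fun=> 1) w) (row j (map_mx intr U)) =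
    \sum_i absC (emat R f i j) ^+ 2.
  rewrite quad_gram; apply: eq_bigr => i _; congr (absC _ ^+ 2).
  rewrite fE mxE; apply: eq_bigr => k _; rewrite !mxE mulrC.
  by rewrite -(rmorph_int (real_complex R)).
have fn i j : absC (emat R f i j) <= n j.
  rewrite -(ger0_norm (absC_ge0 (emat R f i j))) -sqrtr_sqr ler_wsqrtr // Qf.
  by rewrite (bigD1 i) //= lerDl sumr_ge0 // => k _; rewrite exprn_ge0 ?absC_ge0.
have nT : \prod_j n j ^+ 2 <= T ^+ d.
  rewrite Td /C -[absC _ ^+ 2]mul1r.
  have -> : 1 * absC (\det (emat R w)) ^+ 2 = \det (gram_mx (fun=> 1) w).
    by rewrite det_gram_mx ?big1 //; exact: admissible1.
  apply: le_trans HU; rewrite le_eqVlt; apply/orP; left; apply/eqP.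
  by apply: eq_bigr => j _; rewrite sqr_sqrtr // quad_ge0.
have [|V dV VT] := short_products_independent df _ (emat_inj mP df) d0 fn nT (ltW T0)
  (W := emat R w).
  move=> j k; have fO l : inOK lam (f l) by exact: inOK_lincomb.
  have [c Hc] := OK_coordinates mP wB (inOKM (fO j) (fO k)).
  by exists c => i; rewrite Hc evM !mxE.
exists T; split=> //.
exact: (cov_by_independent dw dV VT).
Qed.
End GramMatrix.

(** * Perron numbers *)

Section PerronNumber.
Local Open Scope classical_set_scope.
Variables (R : realType) (lam : R[i]) (P : {poly rat}).
Hypotheses (perl : perron lam) (mP : minpolyQ lam P) (d3 : (3 <= deg P)%N).
Local Notation d := (deg P).
Local Notation cj := (@cj R P).
Let l := complex.Re lam.
Let rho := specratio lam P.

Lemma dPF_le (b : R[i]) n : pf_realizable b n -> (dPF b <= n)%N.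
Proof.
move=> bn; pose Q m := `[< pf_realizable b m >].
have exQ : exists m, Q m by exists n; apply/asboolP.
case: (ex_minnP exQ) => m /asboolP bm mmin.
have : pf_realizable b (dPF b) /\ forall k, pf_realizable b k -> (dPF b <= k)%N.
  apply: (@xgetPex _ 0%N [set n | pf_realizable b n /\
    forall m, pf_realizable b m -> (n <= m)%N]).
  by exists m; split=> // k bk; apply: mmin; apply/asboolP.
by move=> [_]; apply.
Qed.

Lemma perron_real (b : R[i]) : perron b -> b = ((complex.Re b)%:C)%C.
Proof. by move=> [br _]; rewrite RRe_real. Qed.

Lemma perron_eqRe : lam = (l%:C)%C. Proof. exact: perron_real. Qed.

Lemma Re_perron_ge1 : 1 <= l.
Proof. by have [_ [+ _]] := perl; rewrite perron_eqRe -lecR. Qed.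

(** The polynomial [P'] supplied by [perron] vanishes at [lam], hence at every root of [P]. *)
Lemma cj_lt i : cj i != lam -> absC (cj i) < l.
Proof.
have [_ [_ [_ [P' [mP' H]]]]] := perl.
have P'i : ev P' (cj i) = 0 by apply/(ev_lam_cj mP); exact: lam_root mP'.
by move=> /(H _ (introT eqP P'i)); rewrite normC_absC perron_eqRe ltcR.
Qed.

(** The supremum ranges over a finite set, nonempty because the degree exceeds 1, so the largest
    ratio, which is below 1, bounds it. *)
Lemma specratio_props : [/\ 0 <= rho, rho < 1 &
  forall i, cj i != lam -> absC (cj i) <= rho * l].
Proof.
have l0 : 0 < l by apply: lt_le_trans Re_perron_ge1.
have [i0 i0l] := cj_surj mP (lam_root mP).
have [i1 i1l] : exists i, cj i != lam.
  have d1 : (1 < d)%N by apply: leq_trans d3.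
  have [h|h] := eqVneq (val i0) 0%N; [exists (Ordinal d1)|exists (Ordinal (ltnW d1))];
    by rewrite -i0l (inj_eq (cj_inj mP)) -val_eqE /= ?h // eq_sym.
pose E := [set r | exists mu, root (map_poly ratr P) mu /\ mu != lam /\
                          r = absC mu / complex.Re lam].
have EP i : cj i != lam -> E (absC (cj i) / l).
  by move=> il; exists (cj i); split; [apply/eqP/(cjP mP)|].
have [j jl jmax] := seq_argmin (fun i => - absC (cj i)) (s := [seq i <- enum 'I_d | cj i != lam])
   (x0 := i1) ltac:(by rewrite mem_filter i1l mem_enum).
move: jl; rewrite mem_filter => /andP[jl _].
have ubE : ubound E (absC (cj j) / l).
  move=> _ [mu [rmu [mul ->]]]; have [i Di] := cj_surj mP (eqP rmu).
  rewrite ler_pM2r ?invr_gt0 // -Di -lerN2; apply: jmax.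
  by rewrite mem_filter Di mul mem_enum.
have supE : has_sup E by split; [exists (absC (cj i1) / l); exact: EP|exists (absC (cj j) / l)].
split.
- apply: le_trans (ub_le_sup supE.2 (EP _ i1l)).
  by rewrite divr_ge0 ?absC_ge0 // ltW.
- apply: le_lt_trans (ge_sup supE.1 ubE) _.
  by rewrite ltr_pdivrMr // mul1r cj_lt.
move=> i il; rewrite -ler_pdivrMr //.
by apply: ub_le_sup; [exact: supE.2|exact: EP].
Qed.

(** The cone construction for [O_K], with [Lam] multiplication by [lam] in the coordinates of
    [w]. *)
Lemma field_realizable (w : 'I_d -> {poly rat}) a r : Zbasis lam w -> 1 + 4 / (1 - rho) < l ->
  (forall i, 0 < a i) -> 0 < r -> cov_by w a r ->
  (dPF lam)%:R * absC (\det (emat R w)) * \prod_i a i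
    <= (47 / (1 - rho)) ^+ d * (d`!%:R * (3 * r) ^+ d).
Proof.
move=> wB lgt a0 r0 cov.
have [_ [_ [lamI _]]] := perl; have [wO _] := wB.
have dw := Zbasis_det mP lamI wB.
have [rho0 rho1 rhole] := specratio_props.
have [i0 i0l] := cj_surj mP (lam_root mP).
have [Lam LamE] := choice (fun z =>
  OK_coordinates mP wB (inOKM (inOKX lamI) (inOK_lincomb z wO))).
have [t z|t|z i||i ii0|z|n nreal nle] := cone_realizable (i0 := i0) (Lam := Lam)
    (lam := cj) (l := l) (rho := rho) a0 r0 dw _ _ _ _ _ _ rho0 rho1 lgt.
- apply: cov => i j ij; rewrite rmorphM /= conj_real; congr (_ * _).
  by rewrite !emb_emat ij ev_conj.
- apply: cov => i j ij.
  (* The axis point is compatible with conjugation because [lam] is real. *)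
  have -> : (j == i0) = (i == i0).
    rewrite -!(inj_eq (cj_inj mP)) ij i0l perron_eqRe; apply/eqP/eqP => [E|->].
      by rewrite -[LHS]conjCK E conj_real.
    by rewrite conj_real.
  by case: eqP => _; rewrite ?conj_real ?conjC0.
- by rewrite LamE evM evX emb_emat.
- by rewrite i0l -perron_eqRe.
- by apply: rhole; rewrite -i0l (inj_eq (cj_inj mP)).
- by rewrite RRe_real // emb_emat; apply/CrealP; rewrite -ev_conj i0l perron_eqRe conj_real.
rewrite perron_eqRe; apply: le_trans nle.
rewrite ler_wpM2r //; first by rewrite ltW // prodr_gt0.
by rewrite ler_wpM2r ?absC_ge0 // ler_nat dPF_le.
Qed.

(** The values [q(cj i)] are roots of the minimal polynomial of [b], which [b] dominates. *)
Lemma conj_perron_le b q i : perron b -> b = ev q lam ->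
  absC (ev q (cj i)) <= complex.Re b.
Proof.
move=> perb Db; have [_ [b1 [_ [P' [[_ [_ P'b]] H]]]]] := perb.
have P'q : ev P' (ev q (cj i)) = 0.
  have E z : ev P' (ev q z) = ev (P' \Po q) z by rewrite /ev map_comp_poly horner_comp.
  by rewrite E; apply/(ev_lam_cj mP); rewrite -E -Db; apply/eqP.
rewrite -lecR -normC_absC -(perron_real perb).
have [->|/(H _ (introT eqP P'q))/ltW//] := eqVneq (ev q (cj i)) b.
by rewrite ger0_norm // (le_trans _ b1).
Qed.

(* In a Z-basis of [O_K], Perron numbers of bounded size have bounded integer
   coordinates, so [kappa] is a maximum over a finite set. *)
Lemma dPF_le_kappa : l <= 1 + 4 / (1 - rho) -> (dPF lam)%:R <= kappa lam rho.
Proof.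
move=> lM; have [_ [_ [lamI _]]] := perl.
have [w [wB dw]] := Zbasis_exists mP lamI.
have [i0 i0l] := cj_surj mP (lam_root mP).
pose M := 1 + 4 / (1 - rho).
have M0 : 0 <= M by apply: le_trans lM; apply: le_trans Re_perron_ge1.
have uW : (emat R w)^T \in unitmx by rewrite unitmx_tr unitmxE unitfE.
(* Inverting the matrix of embeddings bounds coordinates by the sizes of the conjugates, which are
   at most [M]. *)
pose C := \sum_j \sum_i M * absC (invmx (emat R w)^T i j).
have C0 : 0 <= C.
  by apply: sumr_ge0 => j _; apply: sumr_ge0 => i _; rewrite mulr_ge0 ?absC_ge0.
have [s sP] := int_box_finite d (Num.bound C).
(* A crude bound on all degrees in the box: it makes the supremum defining [kappa] an upper
   bound. *)
pose B := (\sum_(z <- s) dPF (emb (emat R w) z i0))%N.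
rewrite /kappa; apply: ub_le_sup; last first.
  exists lam; split=> //; split; first by exists 'X; rewrite evX.
  by split=> //; rewrite perron_eqRe !lecR Re_perron_ge1 lM.
exists B%:R => _ [b [perb [[q Db] [/andP[b1 bM] ->]]]].
rewrite ler_nat.
have qO : inOK lam q by rewrite /inOK -Db; have [_ [_ []]] := perb.
have [z Hz] := OK_coordinates mP wB qO.
have zb : emb (emat R w) z i0 = b by rewrite Hz i0l.
have zs : z \in s.
  apply: sP => j; rewrite -(ler_int R) intr_norm.
  have -> : `|(z 0 j)%:~R : R| = absC ((map_mx intr z : 'rV[R[i]]_d) 0 j).
    by rewrite mxE absC_int intr_norm.
  rewrite -[map_mx _ _](mulmxK uW) mxE.
  apply: le_trans (absC_sum _ _ _) _; rewrite -pmulrn.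
  apply: (@le_trans _ _ C); last by rewrite ltW // archi_boundP.
  rewrite /C [leRHS](bigD1 j) //= ler_wpDr //.
    by apply: sumr_ge0 => k _; apply: sumr_ge0 => i _; rewrite mulr_ge0 ?absC_ge0.
  apply: ler_sum => i _; rewrite absCM ler_wpM2r ?absC_ge0 // -embE Hz.
  apply: le_trans (conj_perron_le i perb Db) _.
  by rewrite -lecR -(perron_real perb).
by rewrite /B (big_rem z) //= zb leq_addr.
Qed.
End PerronNumber.

(** * The two bounds *)

Lemma fact_le_exp n : (n`! <= n ^ n)%N.
Proof.
have H k : (k <= n)%N -> (k`! <= n ^ k)%N.
  elim: k => // k IH kn; rewrite factS expnS leq_mul //; exact: IH (ltnW kn).
exact: H.
Qed.

(** After [d! <= d^d] and [(4/3)^C(d,2) <= 2^(d^2)], taking [d]-th roots leaves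
    [141 d^2 e <= (8 d e)^d], where [141 = 47 * 3]; the cube of [8 d e] suffices as [d >= 3]. *)
Lemma constant_le (R : realType) (d : nat) (e : R) : (3 <= d)%N -> 1 <= e ->
  (47 * e) ^+ d * (d`!%:R * 3 ^+ d) * (d%:R ^+ d * (4 / 3) ^+ 'C(d, 2)) <=
  2 ^+ (d ^ 2) * (8 * d%:R * e) ^+ (d ^ 2).
Proof.
move=> d3 e1; have D3 : 3 <= d%:R :> R by rewrite (ler_nat R 3).
have e0 : 0 < e by apply: lt_le_trans e1.
have D0 : 0 < d%:R :> R by apply: lt_le_trans D3.
have h1 : (4 / 3) ^+ 'C(d, 2) <= 2 ^+ (d ^ 2) :> R.
  apply: (@le_trans _ _ (2 ^+ 'C(d, 2))).
    by apply: lerXn2r; rewrite ?nnegrE; lra.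
  rewrite ler_weXn2l ?ler1n // bin2 expnS expn1.
  by rewrite (leq_trans (half_leq (leq_mul (leqnn d) (leq_pred d)))) // -divn2 leq_div.
have h2 : d`!%:R <= d%:R ^+ d :> R by rewrite -natrX ler_nat fact_le_exp.
have h3 : 141 * d%:R ^+ 2 * e <= (8 * d%:R * e) ^+ d.
  have b1 : 1 <= 8 * d%:R * e by nra.
  apply: (@le_trans _ _ ((8 * d%:R * e) ^+ 3)); last by rewrite ler_weXn2l.
  have -> : (8 * d%:R * e) ^+ 3 = 512 * (d%:R * e * e) * (d%:R ^+ 2 * e) by ring.
  rewrite -mulrA ler_wpM2r ?mulr_ge0 ?exprn_ge0 ?(ltW D0) ?(ltW e0) //.
  by have : 1 <= d%:R * e * e; [nra|lra].
have -> : (8 * d%:R * e) ^+ (d ^ 2) = ((8 * d%:R * e) ^+ d) ^+ d.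
  by rewrite -exprM expnS expn1.
apply: (@le_trans _ _ ((47 * e) ^+ d * (d%:R ^+ d * 3 ^+ d) * (d%:R ^+ d * 2 ^+ (d ^ 2)))).
  apply: ler_pM.
  - by rewrite !mulr_ge0 ?exprn_ge0 ?mulr_ge0 ?ler0n ?(ltW e0).
  - by rewrite mulr_ge0 ?exprn_ge0 ?divr_ge0.
  - rewrite ler_wpM2l ?exprn_ge0 ?mulr_ge0 ?(ltW e0) //.
    by rewrite ler_wpM2r ?exprn_ge0.
  by rewrite ler_wpM2l ?exprn_ge0.
rewrite mulrA [leRHS]mulrC ler_wpM2r ?exprn_ge0 // -!exprMn.
rewrite ler_pXn2r ?nnegrE ?(leq_trans _ d3) ?exprn_ge0 ?mulr_ge0 ?(ltW D0) ?(ltW e0) //.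
by apply: le_trans h3; rewrite le_eqVlt; apply/orP; left; apply/eqP; ring.
Qed.

Section Bounds.
Local Open Scope classical_set_scope.
Variables (R : realType) (lam : R[i]) (P : {poly rat}).
Hypotheses (perl : perron lam) (mP : minpolyQ lam P) (d3 : (3 <= deg P)%N).
Local Notation d := (deg P).
Local Notation cj := (@cj R P).
Local Notation l := (complex.Re lam).
Let rho := specratio lam P.
Hypothesis lgt : 1 + 4 / (1 - rho) < l.
Let K : R := 2 ^+ (d ^ 2) * (8 * d%:R / (1 - rho)) ^+ (d ^ 2).

Let rho0 : 0 <= rho. Proof. by have [] := specratio_props perl mP d3. Qed.
Let rho1 : rho < 1. Proof. by have [] := specratio_props perl mP d3. Qed.
Let lamI : algint lam. Proof. by have [_ [_ []]] := perl. Qed.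
Let d0 : (0 < d)%N. Proof. exact: leq_trans d3. Qed.
Let e1 : 1 <= (1 - rho)^-1.
Proof. by rewrite invf_ge1 ?subr_gt0 // gerBl. Qed.
Let K0 : 0 < K.
Proof.
rewrite mulr_gt0 ?exprn_gt0 // divr_gt0 ?subr_gt0 // mulr_gt0 // ltr0n //.
Qed.

(** The factor [c] is 1 for the covering bound; for the discriminant it is [d^d] times Hermite's
    constant. *)
Let K_ge c : 0 <= c -> c <= d%:R ^+ d * (4 / 3) ^+ 'C(d, 2) ->
  (47 / (1 - rho)) ^+ d * (d`!%:R * 3 ^+ d) * c <= K.
Proof.
move=> c0 cle; apply: le_trans (constant_le d3 e1).
by rewrite ler_wpM2l // !mulr_ge0 ?exprn_ge0 ?mulr_ge0 ?(le_trans ler01 e1) ?ler0n.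
Qed.

Let det_gt0 (w : 'I_d -> {poly rat}) : Zbasis lam w -> 0 < absC (\det (emat R w)).
Proof. by move=> wB; rewrite lt_def absC_eq0 (Zbasis_det mP lamI wB) absC_ge0. Qed.

(** With [r = d * T], the power [r ^+ d] contains the squared determinant; one factor cancels the
    covolume and the other is the root of [|D|]. *)
Lemma dPF_le_disc : (dPF lam)%:R <= K * Num.sqrt (absC (discK lam P)).
Proof.
have [w0 [w0B _]] := Zbasis_exists mP lamI.
have [w [wB ED]] : exists w : 'I_d -> {poly rat}, Zbasis lam w /\
    discK lam P = (\det (emat R w)) ^+ 2.
  pose E := [set D : R[i] | exists w, Zbasis lam w /\
    D = (\det (\matrix_(i < deg P, j < deg P) ev (w j) (nth 0 (conjs R P) i))) ^+ 2].
  have [w [wB Dw]] : E (xget 0 E) by apply: xgetPex; exists (\det (emat R w0) ^+ 2), w0.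
  by exists w.
have D0 := det_gt0 wB.
rewrite ED absCX sqrtr_sqr ger0_norm ?absC_ge0 //.
have [T [T0 Td cov]] := cov_by_disc mP lamI wB d0.
have dp : 0 < d%:R :> R by rewrite ltr0n.
have := field_realizable perl mP d3 wB lgt (fun=> ltr01) (mulr_gt0 dp T0) cov.
rewrite big1 // mulr1 => H; rewrite -(ler_pM2r D0); apply: le_trans H _.
rewrite !exprMn Td.
have := K_ge (c := d%:R ^+ d * (4 / 3) ^+ 'C(d, 2)) _ (lexx _).
rewrite mulr_ge0 ?exprn_ge0 ?divr_ge0 ?ler0n // => /(_ isT).
rewrite -(ler_pM2r (exprn_gt0 2 D0)) => h; apply: le_trans (le_trans h _).
  by rewrite !exprMn !mulrA.
by rewrite expr2 mulrA.
Qed.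

Lemma sym_extend (x : 'I_d -> R[i]) : (forall i j, cj j = (cj i)^* -> x j = (x i)^*) ->
  exists2 X : R[i] -> R[i], xsym P X & forall i, X (cj i) = x i.
Proof.
move=> xs; pose X z := \sum_i (if cj i == z then x i else 0).
have XE i : X (cj i) = x i.
  rewrite /X (bigD1 i) //= eqxx big1 ?addr0 // => j ji.
  by rewrite (inj_eq (cj_inj mP)) (negPf ji).
exists X => // mu muP; have [i <-] := cj_surj mP (eqP (proj1 ((conjs_spec mP).2 _) muP)).
have [j Dj] := cj_surj mP (z := (cj i)^*) ltac:(by rewrite ev_conj (cjP mP) conjC0).
by rewrite -Dj !XE; apply: xs.
Qed.

(** Rounding in any basis gives a finite covering constant, so the infimum in [covrad] is over a
    nonempty set. *)
Lemma covrad_set_nonempty (alpha : R[i] -> R) : admissible P alpha ->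
  exists u, forall x, xsym P x ->
    exists q, inOK lam q /\ qform P alpha (fun mu => x mu - ev q mu) <= u.
Proof.
move=> adm; have [w [[wO _] dw]] := Zbasis_exists mP lamI.
pose c := \sum_i \sum_j absC (emb (emat R w) (row j 1%:M) i).
have cov : cov_by w (fun=> 1) (d%:R * c).
  apply: (cov_by_independent (V := 1%:M) mP dw); first by rewrite det1.
  move=> i j; rewrite /c (bigD1 i) //= (bigD1 j) //= -addrA lerDl.
  by rewrite addr_ge0 ?sumr_ge0 // => k _; rewrite ?absC_ge0 // sumr_ge0 // => j' _;
    rewrite absC_ge0.
exists (\sum_i alpha (cj i) * (d%:R * c) ^+ 2) => x xs.
have [|z Hz] := cov (fun i => x (cj i)).
  by move=> i j ->; apply: xs; exact: (cj_mem mP).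
exists (lincomb w (map_mx intr z)); split; first exact: inOK_lincomb.
rewrite /qform (big_conjs mP); apply: ler_sum => i _.
rewrite ler_wpM2l //; first by rewrite ltW //; apply: (adm _ (cj_mem mP i)).1.
have := Hz i; rewrite mul1r emb_emat => h.
by rewrite ler_pXn2r ?nnegrE ?absC_ge0 // (le_trans _ h) ?absC_ge0.
Qed.

Lemma qform_ge0 (alpha : R[i] -> R) x : admissible P alpha -> 0 <= qform P alpha x :> R.
Proof.
move=> adm; rewrite /qform (big_conjs mP); apply: sumr_ge0 => i _.
by rewrite mulr_ge0 ?exprn_ge0 ?absC_ge0 // ltW //; apply: (adm _ (cj_mem mP i)).1.
Qed.

(** Each term of [q_alpha] is at most [u], so weights [sqrt alpha] and radius [sqrt u] are
    admissible; the bound is squared to match the Gram determinant. *)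
Lemma dPF_le_cov (w : 'I_d -> {poly rat}) (alpha : R[i] -> R) u :
  admissible P alpha -> Zbasis lam w -> 0 < u ->
  (forall x, xsym P x -> exists q, inOK lam q /\
     qform P alpha (fun mu => x mu - ev q mu) <= u) ->
  (dPF lam)%:R ^+ 2 * \det (gram_mx alpha w) <= K ^+ 2 * u ^+ d.
Proof.
move=> adm wB u0 cov; pose a i := Num.sqrt (alpha (cj i)).
have al0 i : 0 < alpha (cj i) by apply: (adm _ (cj_mem mP i)).1.
have a0 i : 0 < a i by rewrite sqrtr_gt0.
have r0 : 0 < Num.sqrt u by rewrite sqrtr_gt0.
have D0 := det_gt0 wB.
have cova : cov_by w a (Num.sqrt u).
  move=> x /sym_extend [X Xs XE]; have [q [qO qu]] := cov X Xs.
  have [z Hz] := OK_coordinates mP wB qO; exists z => i; rewrite Hz -XE.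
  rewrite -[absC _]ger0_norm ?absC_ge0 // -sqrtr_sqr -sqrtrM ?(ltW (al0 i)) //.
  rewrite ler_wsqrtr //; apply: le_trans qu; rewrite /qform (big_conjs mP) (bigD1 i) //=.
  by rewrite lerDl sumr_ge0 // => j _; rewrite mulr_ge0 ?exprn_ge0 ?absC_ge0 // ltW.
have H := field_realizable perl mP d3 wB lgt a0 r0 cova.
have {}H : (dPF lam)%:R * absC (\det (emat R w)) * \prod_i a i <= K * Num.sqrt u ^+ d.
  apply: le_trans H _; rewrite [(3 * _) ^+ d]exprMn !mulrA ler_wpM2r ?exprn_ge0 ?sqrtr_ge0 //.
  rewrite -mulrA -[leLHS]mulr1; apply: K_ge => //.
  rewrite -[leLHS]mulr1 ler_pM ?exprn_ege1 ?ler1n //.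
  by lra.
rewrite (det_gram_mx mP) //.
have -> : \prod_i alpha (cj i) = (\prod_i a i) ^+ 2.
  by rewrite -prodrXl; apply: eq_bigr => i _; rewrite sqr_sqrtr // ltW.
have -> : u ^+ d = (Num.sqrt u ^+ d) ^+ 2.
  by rewrite exprAC sqr_sqrtr // ltW.
rewrite -!exprMn mulrA mulrAC; rewrite ler_pXn2r ?nnegrE //.
  by rewrite !mulr_ge0 ?ler0n ?absC_ge0 // ltW // prodr_gt0.
by rewrite mulr_ge0 ?exprn_ge0 ?sqrtr_ge0 // ltW.
Qed.

(** Solving the claim for [taumin] gives the number [Y], which is shown to be a lower bound under
    both infima. *)
Lemma dPF_le_taumin : (dPF lam)%:R <= K * powR (taumin lam P) (d%:R / 2).
Proof.
have dn0 : d%:R != 0 :> R by rewrite pnatr_eq0 -lt0n.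
set n : R := (dPF lam)%:R.
have n0 : 0 <= n / K by rewrite divr_ge0 ?ler0n // ltW.
pose Y := powR (n / K) (2 / d%:R).
have Yd : Y ^+ d = (n / K) ^+ 2.
  by rewrite -powR_mulrn ?powR_ge0 // -powRrM divfK // powR_mulrn.
suff HY : Y <= taumin lam P.
  rewrite -ler_pdivrMl // mulrC.
  have -> : n / K = powR Y (d%:R / 2).
    have E : 2 / d%:R * (d%:R / 2) = 1 :> R by field.
    by rewrite -powRrM E powRr1.
  apply: ge0_ler_powR => //; rewrite ?nnegrE ?divr_ge0 ?ler0n ?powR_ge0 //.
  by apply: le_trans HY; rewrite powR_ge0.
apply: lb_le_inf; first by exists (tau lam P (fun=> 1)), (fun=> 1); split=> //; exact: admissible1.
move=> _ [alpha [adm ->]].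
have [w0 [w0B _]] := Zbasis_exists mP lamI.
have [w [wB Dg]] : exists w : 'I_d -> {poly rat}, Zbasis lam w /\
    gramdet lam P alpha = \det (gram_mx alpha w).
  pose E := [set g : R | exists w, Zbasis lam w /\
    g = \det (\matrix_(j < deg P, k < deg P) bform P alpha (ev (w j)) (ev (w k)))].
  have [w [wB Dw]] : E (xget 0 E) by apply: xgetPex; exists (\det (gram_mx alpha w0)), w0.
  by exists w.
have g0 : 0 < gramdet lam P alpha.
  rewrite Dg (det_gram_mx mP) // mulr_gt0 ?exprn_gt0 ?det_gt0 //.
  by apply: prodr_gt0 => i _; apply: (adm _ (cj_mem mP i)).1.
rewrite /tau ler_pdivlMr ?powR_gt0 //.
apply: lb_le_inf; first exact: covrad_set_nonempty.
(* The margin [eta] makes the covering constant strictly positive, as [dPF_le_cov] requires. *)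
move=> u ucov; apply/ler_addgt0Pr => eta eta0.
have u0 : 0 <= u.
  have [|q [_ /(le_trans (qform_ge0 _ adm))//]] := ucov (fun=> 0).
  by move=> mu _; rewrite conjC0.
have U0 : 0 < u + eta by rewrite ltr_wpDl.
rewrite -(@ler_pXn2r _ d) ?nnegrE ?mulr_ge0 ?powR_ge0 ?(ltW U0) //.
have gd : powR (gramdet lam P alpha) (1 / d%:R) ^+ d = gramdet lam P alpha.
  by rewrite -powR_mulrn ?powR_ge0 // -powRrM divfK // powRr1 // ltW.
rewrite exprMn Yd gd expr_div_n mulrAC ler_pdivrMr ?exprn_gt0 // [leRHS]mulrC Dg.
apply: dPF_le_cov => // x xs; have [q [qO qu]] := ucov x xs.
by exists q; split=> //; apply: (le_trans qu); rewrite lerDl ltW.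
Qed.
End Bounds.

Theorem theorem1p6 (R : realType) (lam : R[i]) (P : {poly rat}) :
  perron lam -> minpolyQ lam P -> (3 <= deg P)%N ->
  let d := deg P in
  let rho := specratio lam P in
  let c := (8 * d%:R / (1 - rho)) ^+ (d ^ 2) in
  let bound (B : R) := Num.max (2 ^+ (d ^ 2) * B) (kappa lam rho) in
  ((dPF lam)%:R <= bound (c * powR (taumin lam P) (d%:R / 2))) /\
  ((dPF lam)%:R <= bound (c * Num.sqrt (absC (discK lam P)))).
Proof.
move=> perl mP d3 d rho c bound.
have [lle|lgt] := leP (complex.Re lam) (1 + 4 / (1 - rho)).
  by split; rewrite le_max (dPF_le_kappa perl mP lle) orbT.
split; rewrite /bound le_max mulrA.
  by rewrite (dPF_le_taumin perl mP d3 lgt).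
by rewrite (dPF_le_disc perl mP d3 lgt).
Qed.
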